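(* Let $\{(X_n,Y_n), n\ge 1\}$ be a sequence of bivariate random vectors (not necessarily independent) with common distribution function $F$ having marginals $F_1,F_2$, and let $\{N(t), t\ge 0\}$ be a counting process that is independent of $\{(X_n,Y_n), n\ge 1\}$. Let $p,q\in\mathbb{N}$, let $k_{j1}$ ($1\le j\le p$) and $k_{j2}$ ($1\le j\le q$) be real constants, and put $$S_1(p,t):=\sum_{j=1}^p k_{j1}X_{N(t)-j+1:N(t)},\quad S_2(q,t):=\sum_{j=1}^q k_{j2}Y_{N(t)-j+1:N(t)},\quad c_1:=\sum_{j=1}^p k_{j1},\quad c_2:=\sum_{j=1}^q k_{j2}.$$ Suppose that: (i) $N(t)/t\to\mathcal{Z}$ in probability as $t\to\infty$, where $\mathcal{Z}$ is an almost surely positive random variable; (ii) $a_i(t)>0$, $b_i(t)$, $i=1,2$, are real functions such that $$\lim_{t\to\infty}\ \sup_{(x,y)\in\mathbb{R}^2}\bigl|F^t(a_1(t)x+b_1(t),\,a_2(t)y+b_2(t))-H(x,y)\bigr|=0$$ for a max-stable bivariate distribution function $H$ whose marginals $H_1,H_2$ are standard extreme value distributions (each $H_i$ is one of $\Phi_{\alpha_i}$, $\Psi_{\alpha_i}$, $\alpha_i>0$, or $\Lambda$); (iii) for some $m\ge\max(p,q)$, with these same functions $a_i,b_i$, as $n\to\infty$, $$\Biggl(\Bigl(\tfrac{X_{n-j+1:n}-b_1(n)}{a_1(n)},\tfrac{Y_{n-j+1:n}-b_2(n)}{a_2(n)}\Bigr)\Biggr)_{j=1,\ldots,m}\ \stackrel{d}{\to}\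 \bigl((\mathcal{X}_j,\mathcal{Y}_j)\bigr)_{j=1,\ldots,m}$$ for some random vectors $(\mathcal{X}_j,\mathcal{Y}_j)$, $1\le j\le m$. Then, as $t\to\infty$, $$\Biggl(\frac{S_1(p,t)-b_1(t)c_1}{a_1(t)},\ \frac{S_2(q,t)-b_2(t)c_2}{a_2(t)}\Biggr)\ \stackrel{d}{\to}\ \Biggl(\mathcal{Z}^{\gamma_1}\sum_{j=1}^p k_{j1}\mathcal{X}_j+c_1\delta_1,\ \mathcal{Z}^{\gamma_2}\sum_{j=1}^q k_{j2}\mathcal{Y}_j+c_2\delta_2\Biggr),$$ where on the right-hand side $\mathcal{Z}$ is independent of $((\mathcal{X}_j,\mathcal{Y}_j))_{1\le j\le m}$, and for $i=1,2$: $\gamma_i:=1/\alpha_i$, $-1/\alpha_i$, $0$ if $F_i\in MDA(\Phi_{\alpha_i})$, $MDA(\Psi_{\alpha_i})$, $MDA(\Lambda)$, respectively; $\delta_i:=\ln\mathcal{Z}$ if $F_i\in MDA(\Lambda)$, and $\delta_i:=0$ otherwise.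
   Context: $X_{1:n}\le\cdots\le X_{n:n}$ denote the order statistics of $X_1,\ldots,X_n$, and $Y_{1:n}\le\cdots\le Y_{n:n}$ those of $Y_1,\ldots,Y_n$ (ordering is done separately in each component); $X_{i:N(t)}$, $Y_{i:N(t)}$ are the same with the random sample size $N(t)$. A counting process here means a stochastic process with values in the non-negative integers. The randomly indexed order statistics are considered on the event $\{N(t)\ge \max(p,q)\}$, whose probability tends to $1$; values elsewhere are irrelevant. Standard extreme value distributions: $\Phi_\alpha(x)=\exp(-x^{-\alpha})$, $x>0$ (Fréchet; $0$ for $x\le 0$); $\Psi_\alpha(x)=\exp(-|x|^{\alpha})$, $x<0$ (Weibull; $1$ for $x\ge0$); $\Lambda(x)=\exp(-\exp(-x))$, $x\in\mathbb{R}$ (Gumbel); $\alpha>0$. $G\in MDA(H)$ (max-domain of attraction) means that $G^t$, after suitable affine normalisation of its argument(s) with positive scale functions, converges to $H$ as $t\to\infty$; condition (ii) implies $F_i\in MDA(H_i)$ with normalising functions $a_i,b_i$. $\stackrel{d}{\to}$ is convergence in distribution. *)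

(* Defs.v *)
From HB Require Import structures.
From mathcomp Require Import all_boot all_order all_algebra.
From mathcomp Require Import all_classical all_reals all_analysis.
Import Order.TTheory GRing.Theory Num.Theory.
Import numFieldNormedType.Exports.

Set Implicit Arguments.
Unset Strict Implicit.
Unset Printing Implicit Defensive.

Local Open Scope classical_set_scope.
Local Open Scope ring_scope.

(* The i-th smallest value x_{i:n} (1 <= i <= n) of the n numbers
   x 0, ..., x n.-1; the rank i counts from 1, the sample from 0. *)
Definition order_stat {R : realType} (x : nat -> R) (i n : nat) : R :=
  nth 0 (sort <=%R (mkseq x n)) i.-1.

(* \sum_(1 <= j <= p) k_j x_{n-j+1:n}: the index j < p below is the usual j
   minus 1, so that n - j is the rank n - (j + 1) + 1.  The value is only
   meaningful for p <= n. *)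
Definition upper_sum {R : realType} (p : nat) (k : 'I_p -> R) (x : nat -> R)
    (n : nat) : R :=
  \sum_(j < p) k j * order_stat x (n - j) n.

Section probability.
Context {R : realType}.

Definition joint_df {d : measure_display} {T : measurableType d}
    (P : probability T R) (U V : T -> R) (x y : R) : R :=
  fine (P [set w | U w <= x /\ V w <= y]).

Definition bivariate_df (G : R -> R -> R) : Prop :=
  exists mu : probability (measurableTypeR R * measurableTypeR R)%type R,
    G = joint_df mu fst snd.

Definition marginal1 (G : R -> R -> R) (x : R) : R := lim (G x y @[y --> +oo]).

Definition marginal2 (G : R -> R -> R) (y : R) : R := lim (G x y @[x --> +oo]).

Definition max_stable (G : R -> R -> R) : Prop :=
  forall t : R, 0 < t -> exists a1 b1 a2 b2 : R,
    [/\ 0 < a1, 0 < a2 &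
        forall x y, (G x y) `^ t = G (a1 * x + b1) (a2 * y + b2)].

Section one_space.
Context {d : measure_display} {T : measurableType d}.

Definition sigma_of {d' : measure_display} {T' : measurableType d'} {I : Type}
    (D : set I) (U : I -> T -> T') : set (set T) :=
  <<s \bigcup_(i in D) preimage_set_system setT (U i) measurable >>.

Definition independent (P : probability T R) (A B : set (set T)) : Prop :=
  forall E F, A E -> B F -> P (E `&` F) = (P E * P F)%E.

Definition cvg_in_probability {I : Type} (F : set_system I)
    (P : probability T R) (U : I -> T -> R) (V : T -> R) : Prop :=
  forall eps : R, 0 < eps ->
    P [set w | eps < `|U i w - V w|] @[i --> F] --> 0%E.

End one_space.

(* The limit may live on another probability space. *)
Definition cvg_in_distribution {I : Type} (F : set_system I)
    {S : topologicalType}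
    {d : measure_display} {T : measurableType d} (P : probability T R)
    (U : I -> T -> S)
    {d' : measure_display} {T' : measurableType d'} (P' : probability T' R)
    (V : T' -> S) : Prop :=
  forall f : S -> R, continuous f -> (exists M, forall s, `|f s| <= M) ->
    ('E_P[f \o U i])%E @[i --> F] --> ('E_P'[f \o V])%E.

End probability.

Section extreme_value_laws.
Context {R : realType}.

Variant ev_law : Type :=
  | Frechet of {posnum R}
  | Weibull of {posnum R}
  | Gumbel.

Definition ev_df (L : ev_law) (x : R) : R :=
  match L with
  | Frechet a => if 0 < x then expR (- x `^ (- a%:num)) else 0
  | Weibull a => if x < 0 then expR (- `|x| `^ a%:num) else 1
  | Gumbel => expR (- expR (- x))
  end.

Definition mda (G H : R -> R) : Prop :=
  exists a b : R -> R, (forall t, 0 < t -> 0 < a t) /\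
    forall x, {for x, continuous H} ->
      (G (a t * x + b t)) `^ t @[t --> +oo] --> H x.

Definition ev_exponent (L : ev_law) : R :=
  match L with
  | Frechet a => a%:num^-1
  | Weibull a => - a%:num^-1
  | Gumbel => 0
  end.

(* A distribution function G lies in at most one mda (ev_df L), so the set below
   has at most one element; the default 0 is only reached when there is no
   such L. *)
Definition mda_gamma (G : R -> R) : R :=
  xget 0 [set ev_exponent L | L in [set L | mda G (ev_df L)]].

Definition mda_delta (G : R -> R) (z : R) : R :=
  if `[< mda G (ev_df Gumbel) >] then ln z else 0.

End extreme_value_laws.

Arguments ev_law R : clear implicits.

(* Main.v *)
(** With [Q] the quantile function of an extreme value law in the Gumbel scale,
    [H1 (Q s) = exp (- exp (- s))], the relations [F1^t (a1 t x + b1 t) --> H1 x]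
    and [n / t --> z] give [F1^n (a1 t Q (s + ln z) + b1 t) --> exp (- exp (- s))],
    while [F1^n (a1 n Q s + b1 n)] has the same limit.  Comparing the two by
    monotonicity of [F1] yields [a1 n / a1 t --> z^gamma1] and
    [(b1 n - b1 t) / a1 t --> delta1 z].  The same comparison shows that [F1] lies
    in the domain of attraction of laws with a single exponent [gamma].

    Hence, for a deterministic sample size [n] with [n / t --> z], Slutsky's
    argument turns (iii) into the convergence of
    [g t n := E f ((S1 - b1 t c1) / a1 t, (S2 - b2 t c2) / a2 t)] to a function
    [g' z], locally uniformly in [z > 0].  By independence, the expectation for the
    random sample size is [E g t (N t)], and it converges to [E g' Z] since
    [N t / t --> Z] in probability and [g] is bounded; again by independence,
    [E g' Z] is the expectation of [f] at the asserted limit. *)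

Require Import Defs.
From HB Require Import structures.
From mathcomp Require Import all_boot all_order all_algebra.
From mathcomp Require Import all_classical all_reals all_analysis.
From mathcomp Require Import measurable_realfun ring lra.
Import Order.TTheory GRing.Theory Num.Theory.
Import numFieldNormedType.Exports.

Set Implicit Arguments.
Unset Strict Implicit.
Unset Printing Implicit Defensive.

Local Open Scope classical_set_scope.
Local Open Scope ring_scope.

(** * Extreme value laws in the Gumbel scale *)

Section ev_quantile.
Context {R : realType}.
Implicit Types (L : ev_law R) (s c : R).

(** One increasing parametrisation for all three laws. Its values are the points where [ev_df L]
    lies strictly between 0 and 1, so that convergence of distribution functions can be inverted
    there. *)
Definition ev_quantile L s : R :=
  match L with
  | Frechet _ => expR (ev_exponent L * s)
  | Weibull _ => - expR (ev_exponent L * s)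
  | Gumbel => s
  end.

(** The value of [delta] read off the limit law; [mda_deltaE] identifies it with the one defined
    through the domain of attraction. *)
Definition ev_shift L (z : R) : R := if L is Gumbel then ln z else 0.

Lemma ev_quantile_continuous L : continuous (ev_quantile L).
Proof.
case: L => [a|a|] s.
- apply: (@continuous_comp _ _ _ (fun x : R => ev_exponent (Frechet a) * x) (@expR R)).
    exact: mulrl_continuous.
  exact: continuous_expR.
- apply: cvgN.
  apply: (@continuous_comp _ _ _ (fun x : R => ev_exponent (Weibull a) * x) (@expR R)).
    exact: mulrl_continuous.
  exact: continuous_expR.
- exact: cvg_id.
Qed.

Lemma ev_quantile_lt L : {homo ev_quantile L : x y / x < y}.
Proof.
case: L => [a|a|] x y xy //=.
- by rewrite ltr_expR ltr_pM2l// invr_gt0.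
- by rewrite ltrN2 ltr_expR ltr_nM2l// oppr_lt0 invr_gt0.
Qed.

Lemma ev_df_quantile L s : ev_df L (ev_quantile L s) = expR (- expR (- s)).
Proof.
case: L => [a|a|] //=.
- rewrite expR_gt0 -expRM mulrAC mulrN mulVf ?gt_eqF// mulN1r.
  by [].
- rewrite oppr_lt0 expR_gt0 normrN ger0_norm ?expR_ge0// -expRM.
  by rewrite mulrAC mulNr mulVf ?gt_eqF// mulN1r.
Qed.

(** Membership in [mda] gives convergence at continuity points of the limit only, so the quantile
    points must be known to be such. In the first two cases the sign of the argument is locally
    constant, which fixes the branch of [ev_df]. *)
Lemma ev_df_continuous_quantile L s :
  {for ev_quantile L s, continuous (ev_df L)}.
Proof.
case: L => [a|a|] /=.
- set x0 := expR _; have x0_gt0 : 0 < x0 := expR_gt0 _.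
  pose f (x : R) := expR (- expR (- a%:num * ln x)).
  have cf : {for x0, continuous f}.
    apply: (@continuous_comp _ _ _ (fun x : R => - expR (- a%:num * ln x)) (@expR R));
      last exact: continuous_expR.
    apply: cvgN.
    apply: (@continuous_comp _ _ _ (fun x : R => - a%:num * ln x) (@expR R));
      last exact: continuous_expR.
    apply: (@continuous_comp _ _ _ (@ln R) (fun x => - a%:num * x)); first exact: continuous_ln.
    exact: mulrl_continuous.
  have fE x : 0 < x -> expR (- x `^ (- a%:num)) = f x.
    by move=> xp; rewrite /powR gt_eqF.
  have fx0 : ev_df (Frechet a) x0 = f x0 by rewrite /= x0_gt0 fE.
  rewrite /prop_for /continuous_at fx0; apply: cvg_trans cf; apply: near_eq_cvg.
  near=> x => /=; rewrite ifT ?fE//; near: x; exact: lt_nbhsr.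
- set x0 := - expR _; have x0_lt0 : x0 < 0 by rewrite oppr_lt0 expR_gt0.
  pose f (x : R) := expR (- expR (a%:num * ln (- x))).
  have cf : {for x0, continuous f}.
    apply: (@continuous_comp _ _ _ (fun x : R => - expR (a%:num * ln (- x))) (@expR R));
      last exact: continuous_expR.
    apply: cvgN.
    apply: (@continuous_comp _ _ _ (fun x : R => a%:num * ln (- x)) (@expR R));
      last exact: continuous_expR.
    apply: (@continuous_comp _ _ _ (fun x => ln (- x)) (fun x => a%:num * x));
      last exact: mulrl_continuous.
    apply: (@continuous_comp _ _ _ (fun x => - x) (@ln R)); first exact: (@oppr_continuous R).
    by apply: continuous_ln; rewrite oppr_gt0.
  have fE x : x < 0 -> expR (- `|x| `^ a%:num) = f x.
    by move=> xp; rewrite /powR ltr0_norm// oppr_eq0 lt_eqF.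
  have fx0 : ev_df (Weibull a) x0 = f x0 by rewrite /= x0_lt0 fE.
  rewrite /prop_for /continuous_at fx0; apply: cvg_trans cf; apply: near_eq_cvg.
  near=> x => /=; rewrite ifT ?fE//; near: x; exact: lt_nbhsl.
- apply: (@continuous_comp _ _ _ (fun x : R => - expR (- x)) (@expR R));
    last exact: continuous_expR.
  apply: cvgN.
  apply: (@continuous_comp _ _ _ (fun x => - x) (@expR R)); first exact: (@oppr_continuous R).
  exact: continuous_expR.
Unshelve. all: by end_near. Qed.

(* The ratio of successive increments is thus exp gamma, an affine invariant that
   recovers gamma. *)
Lemma ev_quantile_increment L s c :
  ev_quantile L (s + 1 + c) - ev_quantile L (s + c) =
  expR (ev_exponent L * c) * (ev_quantile L (s + 1) - ev_quantile L s).
Proof.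
case: L => [a|a|] /=; rewrite ?mul0r ?expR0 ?mulrDr ?expRD; ring.
Qed.

(** Translation by [ln z] acts on [ev_quantile L] as an affine map: the increments give its scale,
    the value at 0 gives its shift. *)
Lemma ev_quantile_shift L z : 0 < z ->
  ev_quantile L (ln z) = z `^ ev_exponent L * ev_quantile L 0 + ev_shift L z.
Proof.
move=> z0; case: L => [a|a|] /=; rewrite ?mulr0 ?expR0 /powR ?gt_eqF// ?addr0 ?mulrN ?mulr1//.
by rewrite add0r.
Qed.

Lemma expR_powR (x g : R) : 0 < x -> expR (g * ln x) = x `^ g.
Proof. by move=> x0; rewrite /powR gt_eqF. Qed.

End ev_quantile.

(** * Convergence of types for monotone functions *)

Section convergence_to_types.
Context {R : realType} {I : Type} {F : set_system I} {FF : Filter F}.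

(** Monotone inversion: the limits at [s0 - d / 2], [s0] and [s0 + d / 2] are strictly ordered, so
    eventually [x i] lies between the points normed from [Q (s0 - d / 2)] and [Q (s0 + d / 2)], and
    continuity of [Q] makes this gap small. *)
Lemma cvg_types_point (G : I -> R -> R) (Q : R -> R) (a b x : I -> R) (s0 : R) :
  (forall i, {homo G i : u v / u <= v}) -> (\forall i \near F, 0 < a i) ->
  {homo Q : u v / u < v} -> {for s0, continuous Q} ->
  (forall s, G i (a i * Q s + b i) @[i --> F] --> expR (- expR (- s))) ->
  G i (x i) @[i --> F] --> expR (- expR (- s0)) ->
  (x i - b i) / a i @[i --> F] --> Q s0.
Proof.
move=> Gnd a0 Qlt Qc GQ Gx; apply/cvgrPdist_lt => e e0.
have [d d0 Qd] : exists2 d, 0 < d & forall s, `|s0 - s| < d -> `|Q s0 - Q s| < e.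
  by move/cvgrPdist_lt : Qc => /(_ _ e0) [d /= d0 Qd]; exists d.
have d20 : 0 < d / 2 by rewrite divr_gt0.
have gum u v : u < v -> expR (- expR (- u)) < expR (- expR (- v)) :> R.
  by move=> uv; rewrite ltr_expR ltrN2 ltr_expR ltrN2.
have up : expR (- expR (- s0)) < expR (- expR (- (s0 + d / 2))) by apply: gum; lra.
have lo : expR (- expR (- (s0 - d / 2))) < expR (- expR (- s0)) by apply: gum; lra.
have Qu : `|Q s0 - Q (s0 + d / 2)| < e by apply: Qd; rewrite ltr_norml; lra.
have Ql : `|Q s0 - Q (s0 - d / 2)| < e by apply: Qd; rewrite ltr_norml; lra.
(* Midpoints between neighbouring limits, which eventually separate the values of [G i]. *)
pose mu := (expR (- expR (- s0)) + expR (- expR (- (s0 + d / 2)))) / 2.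
pose ml := (expR (- expR (- s0)) + expR (- expR (- (s0 - d / 2)))) / 2.
near=> i.
have ai : 0 < a i by near: i.
have xu : x i < a i * Q (s0 + d / 2) + b i.
  rewrite ltNge; apply/negP => /(Gnd i); apply/negP; rewrite -ltNge.
  apply: (@lt_trans _ _ mu); near: i.
  - by apply: (cvgr_lt _ Gx); rewrite /mu; lra.
  - by apply: (cvgr_gt _ (GQ _)); rewrite /mu; lra.
have xl : a i * Q (s0 - d / 2) + b i < x i.
  rewrite ltNge; apply/negP => /(Gnd i); apply/negP; rewrite -ltNge.
  apply: (@lt_trans _ _ ml); near: i.
  - by apply: (cvgr_lt _ (GQ _)); rewrite /ml; lra.
  - by apply: (cvgr_gt _ Gx); rewrite /ml; lra.
have xu' : (x i - b i) / a i < Q (s0 + d / 2) by rewrite ltr_pdivrMr// mulrC; lra.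
have xl' : Q (s0 - d / 2) < (x i - b i) / a i by rewrite ltr_pdivlMr// mulrC; lra.
move: (Qu) (Ql) (xu') (xl'); rewrite !ltr_norml => /andP[? ?] /andP[? ?] ? ?.
by apply/andP; split; lra.
Unshelve. all: by end_near. Qed.

Lemma cvg_types (G : I -> R -> R) (Q Q' : R -> R) (a b a' b' : I -> R) :
  (forall i, {homo G i : u v / u <= v}) -> (\forall i \near F, 0 < a i) ->
  {homo Q : u v / u < v} -> continuous Q ->
  (forall s, G i (a i * Q s + b i) @[i --> F] --> expR (- expR (- s))) ->
  (forall s, G i (a' i * Q' s + b' i) @[i --> F] --> expR (- expR (- s))) ->
  forall s, a' i / a i * Q' s + (b' i - b i) / a i @[i --> F] --> Q s.
Proof.
move=> Gnd a0 Qlt Qc GQ GQ' s.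
have := cvg_types_point Gnd a0 Qlt (Qc s) GQ (GQ' s).
apply: cvg_trans; apply: near_eq_cvg; near=> i.
by rewrite !mulrDl mulrAC addrA.
Unshelve. all: by end_near. Qed.

(** Differences cancel the translation [B i] and isolate the scale. *)
Lemma cvg_types_scale (A B : I -> R) (Q Q' : R -> R) :
  (forall s, A i * Q' s + B i @[i --> F] --> Q s) ->
  forall s t, A i * (Q' s - Q' t) @[i --> F] --> Q s - Q t.
Proof.
move=> AB s t; apply: cvg_trans (cvgB (AB s) (AB t)); apply: near_eq_cvg.
near=> i; rewrite !fctE; ring.
Unshelve. all: by end_near. Qed.

Lemma cvg_powR (u r : I -> R) (u0 r0 : R) : 0 < u0 ->
  u @ F --> u0 -> r @ F --> r0 -> u i `^ r i @[i --> F] --> u0 `^ r0.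
Proof.
move=> u0_gt0 uu rr; rewrite -expR_powR//.
apply: (@cvg_trans _ (expR (r i * ln (u i)) @[i --> F])).
  apply: near_eq_cvg; near=> i; rewrite expR_powR//; near: i.
  exact: (cvgr_gt _ uu).
apply: (continuous_cvg _ (@continuous_expR R (r0 * ln u0))).
apply: cvgM => //; exact: (continuous_cvg _ (continuous_ln u0_gt0)).
Unshelve. all: by end_near. Qed.

End convergence_to_types.

(** * Domains of attraction: unique exponent and behaviour of the norming functions *)

Section mda.
Context {R : realType}.
Variables (F1 : R -> R) (L : ev_law R) (a b : R -> R).
Hypothesis F1_nd : {homo F1 : x y / x <= y}.
Hypothesis F1_ge0 : forall x, 0 <= F1 x.
Hypothesis a_gt0 : forall t : R, 0 < t -> 0 < a t.
Hypothesis F1_cvg : forall x, (F1 (a t * x + b t)) `^ t @[t --> +oo] --> ev_df L x.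

Lemma powR_homo (t : R) : 0 <= t -> {homo (fun x => F1 x `^ t) : x y / x <= y}.
Proof. by move=> t0 x y xy; rewrite ge0_ler_powR// ?nnegrE ?F1_nd. Qed.

(** By convergence of types, multiplication by [a' t / a t] carries increments of [ev_quantile L']
    to those of [ev_quantile L] in the limit. Ratios of successive increments are thereby preserved,
    and they are exponentials of the exponents. *)
Lemma mda_exponent_unique L' : mda F1 (ev_df L') -> ev_exponent L' = ev_exponent L.
Proof.
case=> a' [b' [a'_gt0 F1_cvg']].
(* The absolute value makes [G t] nondecreasing for every [t] and changes nothing for large [t]. *)
pose G (t : R) x := F1 x `^ `|t|.
have Gnd t : {homo G t : x y / x <= y} by exact: powR_homo.
have GE (u : R -> R) : G t (u t) @[t --> +oo] `=>` F1 (u t) `^ t @[t --> +oo].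
  apply: near_eq_cvg; near=> t; rewrite /G ger0_norm//; near: t.
have GQ s : G t (a t * ev_quantile L s + b t) @[t --> +oo] --> expR (- expR (- s)).
  by rewrite -(ev_df_quantile L);
    exact: cvg_trans (GE (fun t => a t * ev_quantile L s + b t)) (@F1_cvg (ev_quantile L s)).
have GQ' s : G t (a' t * ev_quantile L' s + b' t) @[t --> +oo] --> expR (- expR (- s)).
  rewrite -(ev_df_quantile L'); have c := F1_cvg' _ (@ev_df_continuous_quantile R L' s).
  exact: cvg_trans (GE (fun t => a' t * ev_quantile L' s + b' t)) c.
have a0 : \forall t \near +oo, 0 < a t.
  by near=> t; apply: a_gt0.
have FF : Filter (+oo : set_system R) := @proper_pinfty_nbhs R.
have AB := cvg_types (FF := FF) Gnd a0 (@ev_quantile_lt _ L) (@ev_quantile_continuous _ L) GQ GQ'.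
have scale := cvg_types_scale (FF := FF) AB.
have incr_gt0 (L0 : ev_law R) : 0 < ev_quantile L0 (0 + 1) - ev_quantile L0 0.
  by rewrite subr_gt0 ev_quantile_lt// add0r ltr01.
(* Both sides are limits of [a' t / a t] times the increment of [ev_quantile L'] from 1 to 2. *)
have eq : expR (ev_exponent L') * (ev_quantile L (0 + 1) - ev_quantile L 0) =
    expR (ev_exponent L) * (ev_quantile L (0 + 1) - ev_quantile L 0).
  have h1 := scale (0 + 1 + 1) (0 + 1).
  have h2 := cvgMl_tmp (a := expR (ev_exponent L')) (scale (0 + 1) 0).
  rewrite [X in _ --> X]ev_quantile_increment mulr1 in h1.
  apply: (@cvg_unique _ (@Rhausdorff R) _ _ _ _ (h2 _)).
  apply: cvg_trans h1; apply: near_eq_cvg; near=> t.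
  by rewrite ev_quantile_increment mulr1 mulrCA.
apply: expR_inj; apply: (mulIf _ eq).
by rewrite gt_eqF.
Unshelve. all: by end_near. Qed.

Lemma mda_ev_df : mda F1 (ev_df L).
Proof. by exists a, b; split. Qed.

(** Every element of the set in [mda_gamma] equals [ev_exponent L], so the choice made by [xget] is
    forced. *)
Lemma mda_gammaE : mda_gamma F1 = ev_exponent L.
Proof.
rewrite /mda_gamma; apply: xget_unique; first by exists L => //; exact: mda_ev_df.
by move=> _ [L' /mda_exponent_unique ? <-].
Qed.

(** The exponent vanishes for the Gumbel law alone, so its uniqueness also decides whether the law
    is Gumbel. *)
Lemma mda_deltaE : mda_delta F1 = ev_shift L.
Proof.
rewrite /mda_delta /ev_shift; apply/funext => z; case: ifPn => /asboolP h.
- have := mda_exponent_unique h; case: L => // e /= /esym/eqP.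
  + by rewrite invr_eq0 gt_eqF.
  + by rewrite oppr_eq0 invr_eq0 gt_eqF.
- by case: L h mda_ev_df.
Qed.

Section regular_variation.
Context {I : Type} {F : set_system I} {FF : Filter F}.
Variables (t : I -> R) (n : I -> nat) (z : R).
Hypothesis z_gt0 : 0 < z.
Hypothesis t_pinfty : t @ F --> +oo.
Hypothesis nt_cvg : (n i)%:R / t i @[i --> F] --> z.

Lemma cvg_natratio_pinfty : (n i)%:R @[i --> F] --> (+oo : set_system R).
Proof.
apply/cvgryPge => M; near=> i.
have ti : 0 < t i by near: i; move/cvgryPgt : t_pinfty; exact.
have r : z / 2 < (n i)%:R / t i.
  by near: i; apply: (cvgr_gt _ nt_cvg); have := z_gt0; lra.
have tM : `|M| / (z / 2) <= t i by near: i; move/cvgryPge : t_pinfty; exact.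
have z20 : 0 < z / 2 by rewrite divr_gt0.
rewrite (le_trans (ler_norm _))//.
move: tM; rewrite ler_pdivrMr// => /le_trans; apply.
by move: r; rewrite ltr_pdivlMr// mulrC => /ltW.
Unshelve. all: by end_near. Qed.

(** Convergence of types compares the norming at [t i], taken with a translated quantile, with the
    norming at [n i]. The filter is arbitrary so that [t] and [n] can vary jointly, as along
    [ratio_nbhs]. *)
Lemma norming_scale_shift_cvg :
  a (n i)%:R / a (t i) @[i --> F] --> z `^ ev_exponent L /\
  (b (n i)%:R - b (t i)) / a (t i) @[i --> F] --> ev_shift L z.
Proof.
have n_oo := cvg_natratio_pinfty.
pose G i x := F1 x `^ (n i)%:R.
have Gnd i : {homo G i : x y / x <= y} by exact: powR_homo.
pose Q s := ev_quantile L (s + ln z).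
have Qlt : {homo Q : u v / u < v} by move=> u v uv; apply: ev_quantile_lt; rewrite ltrD2r.
have Qc : continuous Q.
  move=> s; apply: (@continuous_comp _ _ _ (fun s => s + ln z) (ev_quantile L)).
    by apply: cvgD; [exact: cvg_id|exact: cvg_cst].
  exact: ev_quantile_continuous.
(* In the Gumbel scale the power [z] is undone by a translation by [ln z], whence the definition of
   [Q]. *)
have gumE s : expR (- expR (- (s + ln z))) `^ z = expR (- expR (- s)).
  rewrite -expRM mulNr opprD expRD [expR (- ln z)]expRN lnK ?posrE//.
  by rewrite -mulrA mulVf ?gt_eqF// mulr1.
(* The power [n i] is the power [t i] followed by the power [n i / t i], whose limit is [z]. *)
have GQ s : G i (a (t i) * Q s + b (t i)) @[i --> F] --> expR (- expR (- s)).
  have h := cvg_comp _ _ t_pinfty (@F1_cvg (Q s)).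
  have := cvg_powR _ h nt_cvg.
  rewrite ev_df_quantile expR_gt0 gumE => /(_ _ isT); apply: cvg_trans.
  apply: near_eq_cvg; near=> i => /=; rewrite -powRrM [t i * _]mulrC divfK// gt_eqF//.
  by near: i; move/cvgryPgt : t_pinfty; exact.
have GQ' s : G i (a (n i)%:R * ev_quantile L s + b (n i)%:R) @[i --> F] --> expR (- expR (- s)).
  have := cvg_comp _ _ n_oo (@F1_cvg (ev_quantile L s)).
  by rewrite ev_df_quantile.
have a0 : \forall i \near F, 0 < a (t i).
  by near=> i; apply: a_gt0; near: i; move/cvgryPgt : t_pinfty; exact.
have AB := cvg_types (FF := FF) Gnd a0 Qlt Qc GQ GQ'.
(* The unit increment of [Q] is [expR (ev_exponent L * ln z)] times that of [ev_quantile L], which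
   then cancels. *)
have scale : a (n i)%:R / a (t i) @[i --> F] --> z `^ ev_exponent L.
  have incr := cvg_types_scale (FF := FF) AB.
  have := incr (0 + 1) 0.
  rewrite /Q ev_quantile_increment expR_powR//.
  have d0 : ev_quantile L (0 + 1) - ev_quantile L 0 != 0.
    by rewrite subr_eq0 gt_eqF// ev_quantile_lt// add0r ltr01.
  move=> /(cvgMr_tmp (b:=(ev_quantile L (0 + 1) - ev_quantile L 0)^-1)) /(_ _).
  rewrite mulfK//; apply: cvg_trans; apply: near_eq_cvg; near=> i.
  by rewrite mulfK.
split => //.
(* With the scale known, the convergence at [s = 0] leaves the shift. *)
have Q0 : a (n i)%:R / a (t i) * ev_quantile L 0 @[i --> F] -->
    z `^ ev_exponent L * ev_quantile L 0 by exact: cvgMr_tmp.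
have shift : (a (n i)%:R / a (t i) * ev_quantile L 0 + (b (n i)%:R - b (t i)) / a (t i))
    - a (n i)%:R / a (t i) * ev_quantile L 0 @[i --> F] -->
    Q 0 - z `^ ev_exponent L * ev_quantile L 0 by apply: cvgB => //; exact: AB.
rewrite /Q add0r ev_quantile_shift// addrAC subrr add0r in shift.
by apply: cvg_trans shift; apply: near_eq_cvg; near=> i; rewrite addrAC subrr add0r.
Unshelve. all: by end_near. Qed.

End regular_variation.
End mda.

(** * Bivariate distribution functions and their marginals *)

Section joint_df_lemmas.
Context {R : realType} {d : measure_display} {T : measurableType d}.
Variables (P : probability T R) (U V : T -> R).
Hypotheses (mU : measurable_fun setT U) (mV : measurable_fun setT V).

Lemma measurable_joint_le x y : measurable [set w | U w <= x /\ V w <= y].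
Proof.
have -> : [set w | U w <= x /\ V w <= y] =
    ([set: T] `&` U @^-1` `]-oo, x]) `&` ([set: T] `&` V @^-1` `]-oo, y]).
  by rewrite !setTI; apply/seteqP; split => w; rewrite /= !in_itv.
by apply: measurableI; [exact: mU|exact: mV].
Qed.

Lemma joint_df_ge0 x y : 0 <= joint_df P U V x y.
Proof. exact: fine_ge0. Qed.

Lemma joint_df_le1 x y : joint_df P U V x y <= 1.
Proof.
rewrite -lee_fin fineK ?fin_num_measure// ?probability_le1//;
exact: measurable_joint_le.
Qed.

Lemma joint_df_homo x x' y y' : x <= x' -> y <= y' ->
  joint_df P U V x y <= joint_df P U V x' y'.
Proof.
move=> xx yy; rewrite fine_le ?fin_num_measure//; try exact: measurable_joint_le.
apply: le_measure; rewrite ?inE; try exact: measurable_joint_le.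
by move=> w /= [ux vy]; split; [exact: le_trans xx|exact: le_trans yy].
Qed.

End joint_df_lemmas.

Section marginal.
Context {R : realType}.

(** The properties of a joint distribution function on which the passage to marginals rests. They
    are symmetric in the two arguments, so results on the second marginal follow by exchange. *)
Record monotone_df2 (G : R -> R -> R) : Prop := MonotoneDf2 {
  df2_ge0 : forall x y, 0 <= G x y;
  df2_le1 : forall x y, G x y <= 1;
  df2_homo : forall x x' y y', x <= x' -> y <= y' -> G x y <= G x' y' }.

Lemma monotone_df2_joint_df d (T : measurableType d) (P : probability T R)
    (U V : T -> R) : measurable_fun setT U -> measurable_fun setT V ->
  monotone_df2 (joint_df P U V).
Proof.
move=> mU mV; split => *; [exact: joint_df_ge0|exact: joint_df_le1|].
exact: joint_df_homo.
Qed.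

Lemma monotone_df2_swap G : monotone_df2 G -> monotone_df2 (fun x y => G y x).
Proof. by case=> ? ? h; split => // *; exact: h. Qed.

Section one_df.
Variables (G : R -> R -> R) (hG : monotone_df2 G).

Lemma marginal1_cvg x : G x y @[y --> +oo] --> marginal1 G x.
Proof.
suff : cvg (G x y @[y --> +oo]) by [].
apply/cvg_ex; exists (sup (range (G x))); apply: nondecreasing_cvgr.
  by move=> u v uv; exact: df2_homo.
by exists 1 => _ [y _ <-]; exact: df2_le1.
Qed.

Lemma marginal1_ge x y : G x y <= marginal1 G x.
Proof.
apply: limr_ge; first exact: marginal1_cvg.
by near=> z; apply: df2_homo.
Unshelve. all: by end_near. Qed.

Lemma marginal1_ge0 x : 0 <= marginal1 G x.
Proof. exact: le_trans (df2_ge0 hG x 0) (marginal1_ge _ _). Qed.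

Lemma marginal1_homo : {homo marginal1 G : x y / x <= y}.
Proof.
move=> x x' xx; apply: limr_le; first exact: marginal1_cvg.
near=> y; apply: le_trans (marginal1_ge x' y); exact: df2_homo.
Unshelve. all: by end_near. Qed.

End one_df.

Lemma cvg_affine_pinfty (a b : R) : 0 < a -> a * y + b @[y --> +oo] --> (+oo : set_system R).
Proof.
move=> a0; apply/cvgryPge => M; near=> y.
by rewrite -lerBlDr mulrC -ler_pdivrMr//.
Unshelve. all: by end_near. Qed.

(** Uniformity gives, at a fixed large [t], the bound [e] for all [y] at once, and this bound
    survives the limit [y --> +oo]. *)
Lemma marginal1_power_cvg (F H : R -> R -> R) (a1 b1 a2 b2 : R -> R) :
  monotone_df2 F -> monotone_df2 H -> (forall t, 0 < t -> 0 < a2 t) ->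
  sup [set `| F (a1 t * z.1 + b1 t) (a2 t * z.2 + b2 t) `^ t - H z.1 z.2 |
      | z in [set: R * R]] @[t --> +oo] --> 0 ->
  forall x, marginal1 F (a1 t * x + b1 t) `^ t @[t --> +oo] --> marginal1 H x.
Proof.
move=> hF hH ha2 hFH x; apply/cvgrPdist_le => e e0.
near=> t.
have t0 : 0 < t by [].
have supe : sup [set `| F (a1 t * z.1 + b1 t) (a2 t * z.2 + b2 t) `^ t - H z.1 z.2 |
      | z in [set: R * R]] <= e.
  by near: t; move/cvgrPdist_le : hFH => /(_ _ e0);
    apply: filterS => t; rewrite sub0r normrN; exact/le_trans/ler_norm.
(* [sup] is an upper bound only of a bounded set; here both terms lie in [0, 1], so 1 bounds it. *)
have dist y : `|F (a1 t * x + b1 t) (a2 t * y + b2 t) `^ t - H x y| <= e.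
  apply: le_trans supe; apply: ub_le_sup; last by exists (x, y).
  exists 1 => _ [z _ <-].
  have := df2_ge0 hH z.1 z.2; have := df2_le1 hH z.1 z.2.
  have := powR_ge0 (F (a1 t * z.1 + b1 t) (a2 t * z.2 + b2 t)) t.
  have : F (a1 t * z.1 + b1 t) (a2 t * z.2 + b2 t) `^ t <= 1 `^ t.
    by rewrite ge0_ler_powR ?nnegrE ?(df2_ge0 hF) ?(df2_le1 hF) ?(ltW t0).
  by rewrite powR1 ler_norml => *; apply/andP; split; lra.
have Fy : F (a1 t * x + b1 t) (a2 t * y + b2 t) @[y --> +oo] --> marginal1 F (a1 t * x + b1 t).
  have aff : a2 t * y + b2 t @[y --> +oo] --> (+oo : set_system R).
    by apply: cvg_affine_pinfty; exact: ha2.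
  have mar : F (a1 t * x + b1 t) y @[y --> +oo] --> marginal1 F (a1 t * x + b1 t).
    exact: marginal1_cvg.
  exact: (cvg_comp _ _ aff mar).
have Fpow : F (a1 t * x + b1 t) (a2 t * y + b2 t) `^ t
  @[y --> +oo] --> marginal1 F (a1 t * x + b1 t) `^ t.
  (* [cvg_powR] wants a positive limit of the base; where the marginal vanishes, [F] vanishes for
     every [y]. *)
  have := marginal1_ge0 hF (a1 t * x + b1 t); rewrite le_eqVlt => /predU1P[F0|F_gt0].
    rewrite -F0; have h y : F (a1 t * x + b1 t) y = 0.
      apply/eqP; rewrite eq_le (df2_ge0 hF) andbT F0; exact: marginal1_ge.
    by under eq_fun do rewrite h; exact: cvg_cst.
  by apply: cvg_powR => //; exact: cvg_cst.
have lim : `|F (a1 t * x + b1 t) (a2 t * y + b2 t) `^ t - H x y| @[y --> +oo] -->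
    `|marginal1 F (a1 t * x + b1 t) `^ t - marginal1 H x|.
  by apply: cvg_norm; apply: cvgB => //; exact: marginal1_cvg.
rewrite distrC; apply: (cvgr_to_le lim); exact: nearW.
Unshelve. all: by end_near. Qed.

Lemma marginal2_power_cvg (F H : R -> R -> R) (a1 b1 a2 b2 : R -> R) :
  monotone_df2 F -> monotone_df2 H -> (forall t, 0 < t -> 0 < a1 t) ->
  sup [set `| F (a1 t * z.1 + b1 t) (a2 t * z.2 + b2 t) `^ t - H z.1 z.2 |
      | z in [set: R * R]] @[t --> +oo] --> 0 ->
  forall y, marginal2 F (a2 t * y + b2 t) `^ t @[t --> +oo] --> marginal2 H y.
Proof.
move=> /monotone_df2_swap hF /monotone_df2_swap hH ha1 hFH.
apply: (marginal1_power_cvg hF hH ha1); apply: cvg_trans hFH.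
apply: near_eq_cvg; near=> t; congr sup; apply/seteqP; split => _ [[u v] _ <-];
  by exists (v, u).
Unshelve. all: by end_near. Qed.

End marginal.

(** * Measurability of order statistics and of continuous functions on the plane *)

Lemma measurable_fun_nat d0 (T1 : measurableType d0) (f : nat -> T1) :
  measurable_fun setT f.
Proof. by []. Qed.

Section measurability.
Context {R : realType} {d : measure_display} {T : measurableType d}.

(** Replaces sorting by counting; the count is a sum of indicators, hence measurable in the
    sample. *)
Lemma lt_nth_sort (x : nat -> R) (n k : nat) (c : R) : (k < n)%N ->
  (c < nth 0 (sort <=%R (mkseq x n)) k) = (count (fun y => (y <= c)%R) (mkseq x n) <= k)%N.
Proof.
move=> kn; have s_sorted := sort_le_sorted (mkseq x n).
rewrite -(permP (permEl (perm_sort <=%R (mkseq x n)))).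
set s := sort _ _ in s_sorted *.
have size_s : size s = n by rewrite size_sort size_mkseq.
apply/idP/idP => [|ck].
  by apply: contraTT; rewrite -ltnNge -leNgt; exact: nth_count_le.
by apply: nth_count_gt => //; rewrite size_s kn andbT.
Qed.

Lemma measurable_order_stat (X : nat -> T -> R) (k n : nat) :
  (forall i, measurable_fun setT (X i)) ->
  measurable_fun setT (fun w => order_stat (X ^~ w) k n).
Proof.
(* A rank beyond the sample size returns the default 0 of [nth]. *)
move=> mX; have [nk|kn] := leqP n k.-1.
  rewrite (_ : (fun w => _) = cst 0); first exact: measurable_cst.
  by apply/funext => w; rewrite /order_stat nth_default// size_sort size_mkseq.
apply: (measurability _ (RGenOInfty.measurableE R)) => _ [_ [c ->] <-].
pose S w : R := \sum_(i < n) \1_(X i @^-1` `]-oo, c]) w.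
have SE w : S w = (count (fun y => (y <= c)%R) (mkseq (X ^~ w) n))%:R.
  rewrite /S -(big_mkord xpredT (fun i => \1_(X i @^-1` `]-oo, c]) w)).
  rewrite /index_iota subn0 /mkseq count_map -sum1_count [in RHS]big_mkcond natr_sum.
  apply: eq_bigr => i _; rewrite indicE /=.
  suff -> : (w \in X i @^-1` `]-oo, c]) = (X i w <= c) by case: ifP.
  by apply/idP/idP; [move/set_mem|move=> ?; apply/mem_set]; rewrite /= in_itv.
have mS : measurable_fun setT S.
  apply: measurable_sum => i; apply: measurable_indic.
  by rewrite -[X in measurable X]setTI; exact: mX.
rewrite (_ : _ `&` _ = setT `&` S @^-1` `]-oo, (k.-1.+1)%:R[); first exact: mS.
rewrite !setTI; apply/seteqP; split => w;
  by rewrite /= !in_itv /= andbT /order_stat lt_nth_sort// SE ltr_nat ltnS.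
Qed.

End measurability.

Section measurable_continuous2.
Context {R : realType}.

(** An open set is the countable union of the rational open squares inside it; in [Wbox] the other
    squares are replaced by the empty set. *)
Lemma open_measurable2 (W : set (R * R)) : open W -> measurable W.
Proof.
move=> oW.
pose box (p q r : rat) : set (R * R) :=
  `]ratr p - ratr r, ratr p + ratr r[ `*` `]ratr q - ratr r, ratr q + ratr r[.
pose Wbox p q r := if `[< box p q r `<=` W >] then box p q r else set0.
have -> : W = \bigcup_p \bigcup_q \bigcup_r Wbox p q r.
  apply/seteqP; split => [[x y] Wxy|xy [p _ [q _ [r _]]]]; last first.
    by rewrite /Wbox; case: asboolP => // sub /sub.
  have [e /= e0 We] : exists2 e : R, 0 < e & ball (x, y) e `<=` W.
    by move/nbhs_ballP : (oW _ Wxy) => [e e0 ?]; exists e.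
  (* A square of half-side [r < e / 2] that contains the point lies in the ball of radius [e]. *)
  have [r] : exists r : rat, ratr r \in `]0, (e / 2)[ by apply: rat_in_itvoo; rewrite divr_gt0.
  rewrite in_itv /= => /andP[r0 re].
  have [p] : exists p : rat, ratr p \in `](x - ratr r), (x + ratr r)[ by apply: rat_in_itvoo; lra.
  rewrite in_itv /= => /andP[px xp].
  have [q] : exists q : rat, ratr q \in `](y - ratr r), (y + ratr r)[ by apply: rat_in_itvoo; lra.
  rewrite in_itv /= => /andP[qy yq].
  exists p => //; exists q => //; exists r => //.
  rewrite /Wbox; case: asboolP => [_|]; last first.
    case=> -[u v] [/=]; rewrite !in_itv /= => /andP[u1 u2] /andP[v1 v2].
    apply: We; split; rewrite /ball /= ltr_norml; apply/andP; split; lra.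
  by split; rewrite /= in_itv /=; apply/andP; split; lra.
apply: bigcupT_measurable_rat => p; apply: bigcupT_measurable_rat => q.
apply: bigcupT_measurable_rat => r; rewrite /Wbox; case: ifP => // _.
exact: measurableX.
Qed.

Lemma continuous_measurable_fun2 (f : R * R -> R) : continuous f ->
  measurable_fun setT f.
Proof.
move=> /continuousP cf; apply: (measurability _ (RGenOpens.measurableE R)).
move=> _ [_ [a [b ->] <-]]; rewrite setTI; apply: open_measurable2.
exact/cf/interval_open.
Qed.

Lemma measurable_fun_nat_prod d (T : measurableType d) (h : nat * T -> R) :
  (forall n, measurable_fun setT (fun w => h (n, w))) -> measurable_fun setT h.
Proof.
move=> mh _ B mB; rewrite setTI.
have -> : h @^-1` B = \bigcup_n ([set n] `*` ((fun w => h (n, w)) @^-1` B)).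
  apply/seteqP; split => [[n w] /= Bh|[n w] [k _ [/= ->]]] //.
  by exists n.
apply: bigcupT_measurable => n; apply: measurableX => //.
by rewrite -[X in measurable X]setTI; exact: mh.
Qed.

End measurable_continuous2.

(** * Expectations of bounded random variables *)

Section bounded_expectation.
Context {R : realType} {d : measure_display} {T : measurableType d}.
Variable P : probability T R.

Lemma integrable_bounded (f : T -> R) (M : R) : measurable_fun setT f ->
  (forall w, `|f w| <= M) -> P.-integrable setT (EFin \o f).
Proof.
move=> mf fM; apply: measurable_bounded_integrable => //.
  by rewrite (le_lt_trans (probability_le1 _ _))// ltry.
exists M; split; first exact: num_real.
by move=> x Mx w _; exact: le_trans (fM w) (ltW Mx).
Qed.

Lemma expectation_bounded (f : T -> R) (M : R) : measurable_fun setT f ->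
  (forall w, `|f w| <= M) -> 'E_P[f]%E = (\int[P]_w f w)%:E.
Proof.
move=> mf fM; rewrite unlock /Rintegral fineK//.
exact: (integrable_fin_num measurableT (integrable_bounded mf fM)).
Qed.

Lemma Rintegral_cst1 (r : R) : \int[P]_w r = r.
Proof. by rewrite Rintegral_cst// [X in fine X]probability_setT mulr1. Qed.

Lemma le_Rintegral_dist (f g h : T -> R) (M : R) :
  measurable_fun setT f -> measurable_fun setT g -> measurable_fun setT h ->
  (forall w, `|f w| <= M) -> (forall w, `|g w| <= M) -> (forall w, `|h w| <= M) ->
  (forall w, `|f w - g w| <= h w) ->
  `|\int[P]_w f w - \int[P]_w g w| <= \int[P]_w h w.
Proof.
move=> mf mg mh fM gM hM fgh.
have fgM w : `|f w - g w| <= M by apply: le_trans (fgh w) (le_trans (ler_norm _) (hM w)).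
have mfg : measurable_fun setT (fun w => f w - g w) by exact: measurable_funB.
rewrite -RintegralB//; try exact: integrable_bounded.
apply: le_trans (le_normr_Rintegral _ _) _ => //; first exact: integrable_bounded fgM.
apply: le_Rintegral => //; last exact: integrable_bounded hM.
by apply: (@integrable_bounded _ M) => [|w]; [exact: measurableT_comp|rewrite normr_id].
Qed.

Lemma Rintegral_bounded (f : T -> R) (M : R) : measurable_fun setT f ->
  (forall w, `|f w| <= M) -> `|\int[P]_w f w| <= M.
Proof.
move=> mf fM; have := @le_Rintegral_dist f (fun=> 0) (fun=> M) M mf.
have M0 : 0 <= M := le_trans (normr_ge0 _) (fM point).
rewrite !Rintegral_cst1 subr0; apply => //.
- by move=> w; rewrite normr0.
- by move=> w; rewrite ger0_norm.
- by move=> w; rewrite subr0.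
Qed.

Lemma Rintegral_indicator (A : set T) : measurable A -> \int[P]_w \1_A w = fine (P A).
Proof. by move=> mA; rewrite /Rintegral integral_indic// setIT. Qed.

Lemma tail_lt (X : T -> R) : measurable_fun setT X -> forall e : R, 0 < e ->
  exists2 K : R, 0 < K & fine (P [set w | K < X w]) < e.
Proof.
move=> mX e e0.
pose X' : {RV P >-> R} := HB.pack X (isMeasurableFun.Build _ _ _ _ X mX).
have := cvg_ccdfy0 X' => /fine_cvgP[_] /cvgrPdist_lt /(_ _ e0) h.
near (+oo : set_system R) => K; exists K => //.
have : `|0 - (fine \o ccdf X') K| < e by near: K.
rewrite sub0r normrN ger0_norm ?fine_ge0//= /ccdf /distribution /pushforward.
by congr (fine (P _) < _); apply/seteqP; split => w /=; rewrite in_itv /= andbT.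
Unshelve. all: by end_near. Qed.

End bounded_expectation.

(** * Independence and iterated expectations *)

Section independence.
Context {R : realType} {d : measure_display} {T : measurableType d}.
Variable P : probability T R.
Context {d1 d2 : measure_display} {T1 : measurableType d1} {T2 : measurableType d2}.
Variables (U : {RV P >-> T1}) (V : {RV P >-> T2}).
Hypothesis indep : forall A B, measurable A -> measurable B ->
  P (U @^-1` A `&` V @^-1` B) = (P (U @^-1` A) * P (V @^-1` B))%E.
Variables (h : T1 * T2 -> R) (M : R).
Hypothesis mh : measurable_fun setT h.
Hypothesis hM : forall z, `|h z| <= M.

Let mhx x : measurable_fun setT (fun y => h (x, y)).
Proof. exact: (measurableT_comp mh (measurable_pair1 x)). Qed.

Let inner x : (\int[distribution P V]_y (h (x, y))%:E)%E = (\int[P]_w h (x, V w))%:E.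
Proof.
rewrite integral_distribution; last 2 first.
- exact/measurable_EFinP/mhx.
- apply: (@integrable_bounded _ _ _ P (fun w => h (x, V w)) M) => //.
  exact: (measurableT_comp (mhx x)).
rewrite /Rintegral fineK//; apply: (integrable_fin_num measurableT).
apply: (@integrable_bounded _ _ _ P (fun w => h (x, V w)) M) => //.
exact: (measurableT_comp (mhx x)).
Qed.

Let int_prod : (distribution P U \x distribution P V)%E.-integrable setT (EFin \o h).
Proof.
apply: (@measurable_bounded_integrable _ _ _ _ h setT measurableT) => //.
- rewrite [X in (X < _)%E](@probability_setT _ _ _ (distribution P U \x distribution P V)%E).
  exact: ltry.
- exists M; split; first exact: num_real.
  by move=> x Mx z _; exact: le_trans (hM z) (ltW Mx).
Qed.

Lemma measurable_partial_expectation :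
  measurable_fun setT (fun x => \int[P]_w h (x, V w)).
Proof.
apply/measurable_EFinP.
have := measurable_fubini_F int_prod.
by congr measurable_fun; apply/funext => x; rewrite /fubini_F /= inner.
Qed.

(** Independence identifies the joint law of [U] and [V] with the product of their laws, on
    rectangles and hence everywhere; Fubini's theorem gives the iterated form. *)
Lemma expectation_independent :
  \int[P]_w h (U w, V w) = \int[P]_w \int[P]_w' h (U w, V w').
Proof.
have mUV : measurable_fun setT (fun w => (U w, V w)) by exact: measurable_fun_pair.
pose UV : {RV P >-> (T1 * T2)%type} :=
  HB.pack (fun w => (U w, V w)) (isMeasurableFun.Build _ _ _ _ _ mUV).
have prodE A : measurable A ->
    (distribution P U \x distribution P V)%E A = distribution P UV A.
  by move=> mA; exact: product_measure_unique.
have intUV : P.-integrable setT ((EFin \o h) \o UV).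
  apply: (@integrable_bounded _ _ _ P (fun w => h (U w, V w)) M) => //.
  exact: measurableT_comp.
rewrite /Rintegral; congr fine.
transitivity (\int[distribution P UV]_z (EFin \o h) z)%E.
  by rewrite integral_distribution//; exact/measurable_EFinP.
transitivity (\int[distribution P U \x distribution P V]_z (EFin \o h) z)%E.
  by apply: eq_measure_integral => A mA _; exact/esym/prodE.
rewrite -(integral12_prod_meas1 int_prod) integral_distribution.
- by apply: eq_integral => w _; rewrite /fubini_F /= inner.
- exact: (measurable_fubini_F int_prod).
- rewrite (_ : _ \o U = EFin \o (fun w => \int[P]_w' h (U w, V w'))); last first.
    by apply/funext => w; rewrite /fubini_F /= inner.
  apply: (@integrable_bounded _ _ _ P _ M) => [|w].
    exact: (measurableT_comp measurable_partial_expectation).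
  apply: Rintegral_bounded => //.
  exact: (measurableT_comp (mhx (U w))).
Qed.

End independence.

(** * Slutsky's theorem for affine maps of the plane *)

Section affine2.
Context {R : realType}.

Definition affine2 (a1 b1 a2 b2 : R) (z : R * R) : R * R :=
  (a1 * z.1 + b1, a2 * z.2 + b2).

(** Convergence jointly in the point and the index is what yields uniformity on compact sets. *)
Lemma cvg_pair_affine2 I (F : set_system I) {FF : Filter F}
    (A1 B1 A2 B2 : I -> R) (a1 b1 a2 b2 : R) (z : R * R) :
  A1 @ F --> a1 -> B1 @ F --> b1 -> A2 @ F --> a2 -> B2 @ F --> b2 ->
  affine2 (A1 p.2) (B1 p.2) (A2 p.2) (B2 p.2) p.1 @[p --> filter_prod (nbhs z) F]
  --> affine2 a1 b1 a2 b2 z.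
Proof.
move=> A1_cvg B1_cvg A2_cvg B2_cvg.
have c2 (A : I -> R) (a : R) : A @ F --> a -> A p.2 @[p --> filter_prod (nbhs z) F] --> a.
  by move=> Aa; apply: cvg_comp Aa; exact: cvg_snd.
have z1 : p.1.1 @[p --> filter_prod (nbhs z) F] --> z.1.
  by apply: (@cvg_comp _ _ _ fst fst _ (nbhs z));
    [exact: cvg_fst|case: z {c2} => ? ?; exact: cvg_fst].
have z2 : p.1.2 @[p --> filter_prod (nbhs z) F] --> z.2.
  by apply: (@cvg_comp _ _ _ fst snd _ (nbhs z));
    [exact: cvg_fst|case: z {c2 z1} => ? ?; exact: cvg_snd].
have e1 : A1 p.2 * p.1.1 + B1 p.2 @[p --> filter_prod (nbhs z) F] --> a1 * z.1 + b1.
  by apply: cvgD; [apply: cvgM => //|]; exact: c2.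
have e2 : A2 p.2 * p.1.2 + B2 p.2 @[p --> filter_prod (nbhs z) F] --> a2 * z.2 + b2.
  by apply: cvgD; [apply: cvgM => //|]; exact: c2.
exact: (cvg_pair e1 e2).
Qed.

Lemma continuous_affine2 (a1 b1 a2 b2 : R) : continuous (affine2 a1 b1 a2 b2).
Proof.
move=> -[x y] /=; apply: (@cvg_pair _ _ _ (nbhs (x, y)) (nbhs _) (nbhs _)).
  by apply: cvgD; [apply: cvgM; [exact: cvg_cst|exact: cvg_fst]|exact: cvg_cst].
by apply: cvgD; [apply: cvgM; [exact: cvg_cst|exact: cvg_snd]|exact: cvg_cst].
Qed.

Lemma measurable_affine2 (f : R * R -> R) (a1 b1 a2 b2 : R) d (T : measurableType d)
    (u v : T -> R) : continuous f ->
  measurable_fun setT u -> measurable_fun setT v ->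
  measurable_fun setT (fun w => f (affine2 a1 b1 a2 b2 (u w, v w))).
Proof.
move=> cf mu mv; apply: measurableT_comp; first exact: continuous_measurable_fun2.
by apply: measurable_fun_pair; apply: measurable_funD => //; exact: measurable_funM.
Qed.

End affine2.

Section tail_weight.
Context {R : realType}.

(** A continuous substitute for the indicator of [K < |z.1| + |z.2|]: at most this indicator, and 1
    once the sum reaches [K + 1]. Being continuous, it carries tail bounds through convergence in
    distribution. *)
Definition tail_weight (K : R) (z : R * R) : R :=
  Num.max 0 (Num.min 1 (`|z.1| + `|z.2| - K)).

Lemma tail_weight_continuous K : continuous (tail_weight K).
Proof.
move=> z; apply: (@continuous_max _ _ (fun=> 0) (fun z : R * R => Num.min 1 (`|z.1| + `|z.2| - K))).
  exact: cst_continuous.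
apply: (@continuous_min _ _ (fun=> 1) (fun z : R * R => `|z.1| + `|z.2| - K)).
  exact: cst_continuous.
case: z => x y; apply: cvgB; last exact: cvg_cst.
by apply: cvgD; apply: cvg_norm; [exact: cvg_fst|exact: cvg_snd].
Qed.

Lemma tail_weight_ge0 K z : 0 <= tail_weight K z.
Proof. by rewrite /tail_weight le_max lexx. Qed.

Lemma tail_weight_le1 K z : tail_weight K z <= 1.
Proof. by rewrite /tail_weight ge_max ler01 ge_min lexx. Qed.

Lemma tail_weight_norm K z : `|tail_weight K z| <= 1.
Proof. by rewrite ger0_norm ?tail_weight_ge0 ?tail_weight_le1. Qed.

Lemma tail_weight_eq1 K z : K + 1 <= `|z.1| + `|z.2| -> tail_weight K z = 1.
Proof.
move=> h; rewrite /tail_weight min_l; last by lra.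
by rewrite max_r.
Qed.

Lemma tail_weight_le_indic K z : tail_weight K z <= (K < `|z.1| + `|z.2|)%R%:R.
Proof.
case: ltP => [_|h]; first exact: tail_weight_le1.
by rewrite /tail_weight ge_max lexx /= ge_min; apply/orP; right; lra.
Qed.

End tail_weight.

Lemma Rintegral_affine {R : realType} d (T : measurableType d) (P : probability T R)
    (c k M : R) (f : T -> R) :
  measurable_fun setT f -> (forall w, `|f w| <= M) ->
  \int[P]_w (c + k * f w) = c + k * \int[P]_w f w.
Proof.
move=> mf fM; have intf : P.-integrable setT (EFin \o f) by exact: integrable_bounded fM.
rewrite RintegralD//; last 2 first.
- by apply: (@integrable_bounded _ _ _ _ _ `|c|).
- apply: (@integrable_bounded _ _ _ _ _ (`|k| * M)) => [|w]; first exact: measurable_funM.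
  by rewrite normrM ler_wpM2l.
by rewrite Rintegral_cst1 RintegralZl.
Qed.

Section slutsky.
Context {R : realType}.
Context {d : measure_display} {T : measurableType d} (P : probability T R).
Context {d' : measure_display} {T' : measurableType d'} (P' : probability T' R).
Context {I : Type} {F : set_system I} {FF : Filter F}.
Variables (U V : I -> T -> R) (U' V' : T' -> R).
Hypotheses (mU : forall i, measurable_fun setT (U i))
  (mV : forall i, measurable_fun setT (V i))
  (mU' : measurable_fun setT U') (mV' : measurable_fun setT V').
Hypothesis UV_cvg : forall f : R * R -> R, continuous f ->
  (exists M, forall z, `|f z| <= M) ->
  \int[P]_w f (U i w, V i w) @[i --> F] --> \int[P']_w f (U' w, V' w).
Variables (A1 B1 A2 B2 : I -> R) (a1 b1 a2 b2 : R).
Hypotheses (A1_cvg : A1 @ F --> a1) (B1_cvg : B1 @ F --> b1)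
  (A2_cvg : A2 @ F --> a2) (B2_cvg : B2 @ F --> b2).

(** On a compact square the integrand converges uniformly; outside it the error is at most a
    multiple of [tail_weight], whose expectation is small for the limit, hence eventually. *)
Lemma cvg_affine2_distribution (f : R * R -> R) : continuous f ->
  (exists M, forall z, `|f z| <= M) ->
  \int[P]_w f (affine2 (A1 i) (B1 i) (A2 i) (B2 i) (U i w, V i w)) @[i --> F] -->
  \int[P']_w f (affine2 a1 b1 a2 b2 (U' w, V' w)).
Proof.
move=> cf [M0 fM0]; pose M := `|M0| + 1.
have M_gt0 : 0 < M by rewrite ltr_wpDl.
have fM z : `|f z| <= M by apply: le_trans (fM0 z) _; have := ler_norm M0; rewrite /M; lra.
apply/cvgrPdist_lt => e e0.
(* So that [2 * M * eta = e / 4]; three such quarters make up the final estimate. *)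
pose eta := e / (8 * M).
have eta0 : 0 < eta by rewrite divr_gt0// mulr_gt0.
have Meta : M * eta = e / 8.
  by rewrite /eta; field; rewrite gt_eqF.
pose X w := `|U' w| + `|V' w|.
have mX : measurable_fun setT X by apply: measurable_funD; exact: measurableT_comp.
have [K K0 PK] := tail_lt P' mX eta0.
pose finf z := f (affine2 a1 b1 a2 b2 z).
have cfinf : continuous finf.
  by move=> z; apply: continuous_comp; [exact: (@continuous_affine2 _ a1 b1 a2 b2 z)|exact: cf].
have tail_lim : \int[P']_w tail_weight K (U' w, V' w) < eta.
  apply: le_lt_trans PK; have mA : measurable [set w | K < X w].
    rewrite (_ : mkset _ = setT `&` X @^-1` `]K, +oo[); first exact: mX.
    by rewrite setTI; apply/seteqP; split => w /=; rewrite in_itv /= andbT.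
  rewrite -(Rintegral_indicator P' mA); apply: le_Rintegral => //.
  - apply: (@integrable_bounded _ _ _ _ _ 1) => [|w]; last exact: tail_weight_norm.
    apply: measurableT_comp;
      first by apply: continuous_measurable_fun2; exact: tail_weight_continuous.
    exact: measurable_fun_pair.
  - apply: (@integrable_bounded _ _ _ _ _ 1) => [|w]; first exact: measurable_indic.
    by rewrite indicE normr_nat; case: (_ \in _).
  - move=> w _; apply: le_trans (tail_weight_le_indic _ _) _.
    rewrite indicE /=; case: ltP => //= h.
    by rewrite mem_set.
have tail_cvg : \int[P]_w tail_weight K (U i w, V i w) @[i --> F] -->
    \int[P']_w tail_weight K (U' w, V' w).
  apply: UV_cvg; first exact: tail_weight_continuous.
  by exists 1 => z; exact: tail_weight_norm.
have finf_cvg : \int[P]_w finf (U i w, V i w) @[i --> F] --> \int[P']_w finf (U' w, V' w).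
  by apply: UV_cvg => //; exists M => z; exact: fM.
(* Contains every point where [|z.1| + |z.2| < K + 1]; elsewhere [tail_weight K] is 1. *)
pose box : set (R * R) := `[- (K + 1), K + 1] `*` `[- (K + 1), K + 1].
have box_cpt : compact box by apply: compact_setX; exact: segment_compact.
have e4 : 0 < e / 4 by rewrite divr_gt0.
have unif : \forall i \near F, box `<=`
    (fun z => `|f (affine2 (A1 i) (B1 i) (A2 i) (B2 i) z) - finf z| < e / 4).
  move/compact_near_coveringP : box_cpt; apply => z _.
  have c1 : f (affine2 (A1 p.2) (B1 p.2) (A2 p.2) (B2 p.2) p.1)
      @[p --> filter_prod (nbhs z) F] --> finf z.
    have c0 : affine2 (A1 p.2) (B1 p.2) (A2 p.2) (B2 p.2) p.1
        @[p --> filter_prod (nbhs z) F] --> affine2 a1 b1 a2 b2 z.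
      exact: cvg_pair_affine2.
    exact: (cvg_comp _ _ c0 (cf (affine2 a1 b1 a2 b2 z))).
  have c2 : finf p.1 @[p --> filter_prod (nbhs z) F] --> finf z.
    have c0 : p.1 @[p --> filter_prod (nbhs z) F] --> z by exact: cvg_fst.
    exact: (cvg_comp _ _ c0 (cfinf z)).
  have c3 : f (affine2 (A1 p.2) (B1 p.2) (A2 p.2) (B2 p.2) p.1) - finf p.1
      @[p --> filter_prod (nbhs z) F] --> 0.
    by rewrite -(subrr (finf z)); exact: cvgB.
  by move/cvgr0Pnorm_lt : c3 => /(_ _ e4).
near=> i.
have near_tail : \int[P]_w tail_weight K (U i w, V i w) < eta.
  by near: i; exact: (cvgr_lt _ tail_cvg).
have near_finf : `|\int[P']_w finf (U' w, V' w) - \int[P]_w finf (U i w, V i w)| < e / 4.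
  by near: i; move/cvgrPdist_lt : finf_cvg; exact.
have near_box : box `<=`
    (fun z => `|f (affine2 (A1 i) (B1 i) (A2 i) (B2 i) z) - finf z| < e / 4).
  by near: i.
have mtail : measurable_fun setT (fun w => tail_weight K (U i w, V i w)).
  apply: measurableT_comp;
    first by apply: continuous_measurable_fun2; exact: tail_weight_continuous.
  exact: measurable_fun_pair.
have bound z : `|f (affine2 (A1 i) (B1 i) (A2 i) (B2 i) z) - finf z| <=
    e / 4 + (2 * M) * tail_weight K z.
  have [h|h] := leP (K + 1) (`|z.1| + `|z.2|).
    rewrite tail_weight_eq1// mulr1; apply: le_trans (ler_normB _ _) _.
    by have := fM (affine2 (A1 i) (B1 i) (A2 i) (B2 i) z);
      have := fM (affine2 a1 b1 a2 b2 z); rewrite /finf; lra.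
  have zbox : box z.
    have := normr_ge0 z.1; have := normr_ge0 z.2.
    by move=> ? ?; split; rewrite /= in_itv /= -ler_norml; lra.
  apply: le_trans (ltW (near_box _ zbox)) _; rewrite lerDl.
  by rewrite mulr_ge0 ?tail_weight_ge0// ltW// mulr_gt0.
have dist : `|\int[P]_w f (affine2 (A1 i) (B1 i) (A2 i) (B2 i) (U i w, V i w)) -
    \int[P]_w finf (U i w, V i w)| <= e / 4 + (2 * M) * \int[P]_w tail_weight K (U i w, V i w).
  rewrite -(@Rintegral_affine _ _ _ P _ _ 1)//; last by move=> w; exact: tail_weight_norm.
  apply: (@le_Rintegral_dist _ _ _ _ _ _ _ (e / 4 + 2 * M)).
  - exact: measurable_affine2.
  - exact: measurable_affine2.
  - by apply: measurable_funD => //; exact: measurable_funM.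
  - by move=> w; have := fM (affine2 (A1 i) (B1 i) (A2 i) (B2 i) (U i w, V i w)); lra.
  - by move=> w; have := fM (affine2 a1 b1 a2 b2 (U i w, V i w)); rewrite /finf; lra.
  - move=> w; have t0 := tail_weight_ge0 K (U i w, V i w).
    have t1 := tail_weight_le1 K (U i w, V i w).
    have Mt : 0 <= 2 * M * tail_weight K (U i w, V i w) by rewrite mulr_ge0// mulr_ge0// ltW.
    have Mt1 : 2 * M * tail_weight K (U i w, V i w) <= 2 * M by rewrite ler_piMr// mulr_ge0// ltW.
    by rewrite ger0_norm; lra.
  - by move=> w; exact: bound.
rewrite -(subrK (\int[P]_w finf (U i w, V i w)) (\int[P']_w _)) -addrA.
apply: le_lt_trans (ler_normD _ _) _; rewrite [X in _ + X < _]distrC.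
have : (2 * M) * \int[P]_w tail_weight K (U i w, V i w) <= e / 4.
  apply: (@le_trans _ _ (2 * M * eta));
    first by rewrite ler_wpM2l ?(ltW near_tail)// mulr_ge0// ltW.
  by rewrite -mulrA Meta; lra.
move: (dist) (near_finf); rewrite /finf; lra.
Unshelve. all: by end_near. Qed.

End slutsky.

(** * Sample sizes with a prescribed asymptotic ratio *)

Section ratio_nbhs.
Context {R : realType}.

(** The filter of pairs [(t, n)] for which [t] tends to infinity and [n / t] to [z]. A limit along
    it expresses convergence for all such deterministic sample sizes at once. *)
Definition ratio_nbhs (z : R) : set_system (R * nat) :=
  [set A | exists2 e : R, 0 < e &
     \forall t \near +oo, forall n : nat, `|n%:R / t - z| < e -> A (t, n)].

Global Instance ratio_nbhs_filter z : Filter (ratio_nbhs z).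
Proof.
split.
- by exists 1 => //; near=> t.
- move=> A B [e e0 hA] [e' e'0 hB]; exists (Num.min e e'); first by rewrite lt_min e0.
  near=> t => n; rewrite lt_min => /andP[ne ne']; split.
  + by move: ne; move: n {ne'}; near: t.
  + by move: ne'; move: n {ne}; near: t.
- move=> A B AB [e e0 hA]; exists e => //; near=> t => n ne; apply: AB.
  by move: n ne; near: t.
Unshelve. all: by end_near. Qed.

Lemma ratio_nbhs_fst z : p.1 @[p --> ratio_nbhs z] --> (+oo : set_system R).
Proof.
move=> A hA; exists 1 => //=; apply: filterS hA => t At n _.
exact: At.
Qed.

Lemma ratio_nbhs_ratio z : p.2%:R / p.1 @[p --> ratio_nbhs z] --> z.
Proof.
apply/cvgrPdist_lt => e e0; exists e => //; apply: nearW => t n /=.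
by rewrite distrC.
Qed.

Lemma ratio_nbhs_snd z : 0 < z -> p.2 @[p --> ratio_nbhs z] --> \oo.
Proof.
move=> z0; apply/cvgrnyP.
exact: (cvg_natratio_pinfty z0 (@ratio_nbhs_fst z) (@ratio_nbhs_ratio z)).
Qed.

Lemma ratio_nbhs_inhabited (z e t : R) : 0 < z -> 0 < e -> e^-1 < t ->
  exists n : nat, `|n%:R / t - z| < e.
Proof.
move=> z0 e0 et; have t0 : 0 < t by rewrite (lt_trans _ et)// invr_gt0.
(* Rounding [t * z] down changes the ratio by less than [1 / t < e]. *)
exists (Num.truncn (t * z)).
have /andP[lo hi] := truncn_itv (ltW (mulr_gt0 t0 z0)).
have lo' : (Num.truncn (t * z))%:R / t <= z by rewrite ler_pdivrMr// [z * t]mulrC.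
have hi' : z < (Num.truncn (t * z))%:R / t + t^-1.
  by move: hi; rewrite -natr1 -ltr_pdivlMl// mulrDr mulr1 [X in X + _]mulrC.
have te : t^-1 < e by rewrite invf_plt ?posrE.
by rewrite ltr_norml; apply/andP; split; lra.
Qed.

Section limit.
Variables (g : R -> nat -> R) (g' : R -> R).
Hypothesis g_cvg : forall z : R, 0 < z -> g p.1 p.2 @[p --> ratio_nbhs z] --> g' z.

(** For [z'] near [z] and large [t], some [n / t] is close to both, so the single value [g t n] is
    close to both limits. *)
Lemma ratio_limit_continuous (z e : R) : 0 < z -> 0 < e ->
  \forall z' \near z, `|g' z' - g' z| <= e.
Proof.
move=> z0 e0; have e20 : 0 < e / 2 by rewrite divr_gt0.
have /cvgrPdist_lt /(_ _ e20) [d d0 hd] := g_cvg z0.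
have d20 : 0 < d / 2 by rewrite divr_gt0.
near=> z'.
have z'0 : 0 < z' by near: z'; exact: lt_nbhsr.
have zz' : `|z - z'| < d / 2 by near: z'; apply/nbhs_ballP; exists (d / 2).
have /cvgrPdist_lt /(_ _ e20) [d' d'0 hd'] := g_cvg z'0.
(* [d'] makes [g t n] close to [g' z'], while [d / 2] keeps the ratio within [d] of [z]. *)
pose m := Num.min d' (d / 2).
have m0 : 0 < m by rewrite lt_min d'0.
near (+oo : set_system R) => t.
have mt : m^-1 < t by near: t; apply: nbhs_pinfty_gt; rewrite num_real.
have [n] : exists n : nat, `|n%:R / t - z'| < m by exact: ratio_nbhs_inhabited.
rewrite lt_min => /andP[nd' nd].
have h1 : `|g' z - g t n| < e / 2.
  have nz : `|n%:R / t - z| < d.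
    rewrite -(subrK z' (n%:R / t)) -addrA (le_lt_trans (ler_normD _ _))// [`|z' - z|]distrC; lra.
  by move: n {nd nd'} nz; near: t.
have h2 : `|g' z' - g t n| < e / 2.
  by move: n {nd h1} nd'; near: t.
rewrite -(subrK (g t n) (g' z')) -addrA (le_trans (ler_normD _ _))//.
by rewrite [X in _ + X <= _]distrC; lra.
Unshelve. all: by end_near. Qed.

(** Compactness of [[a, b]] and continuity of the limit turn the limits at each [z] into a uniform
    one. *)
Lemma ratio_limit_uniform (a b e : R) : 0 < a -> 0 < e ->
  exists2 d : R, 0 < d & \forall t \near +oo, forall z (n : nat), a <= z <= b ->
    `|n%:R / t - z| < d -> `|g t n - g' z| <= e.
Proof.
move=> a0 e0; have e20 : 0 < e / 2 by rewrite divr_gt0.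
(* The tolerance [q.1] tends to 0 from the right while [q.2] tends to infinity, so one covering
   argument provides both thresholds. *)
have h : \forall q \near filter_prod (0:R)^'+ (+oo : set_system R),
    `[a, b] `<=` [set z | forall n : nat, `|n%:R / q.2 - z| < q.1 -> `|g q.2 n - g' z| <= e].
  have /compact_near_coveringP := @segment_compact R a b; apply => z /=.
  rewrite in_itv /= => /andP[az zb]; have z0 : 0 < z := lt_le_trans a0 az.
  have /cvgrPdist_lt /(_ _ e20) [d d0 hd] := g_cvg z0.
  have d20 : 0 < d / 2 by rewrite divr_gt0.
  exists ([set z' | `|g' z' - g' z| <= e / 2 /\ `|z - z'| < d / 2],
     [set q : R * R | 0 < q.1 < d / 2 /\
       forall n : nat, `|n%:R / q.2 - z| < d -> `|g' z - g q.2 n| < e / 2]).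
    split => /=.
      apply: filterI; first exact: ratio_limit_continuous.
      by apply/nbhs_ballP; exists (d / 2).
    exists ([set d1 : R | 0 < d1 < d / 2], [set t |
      forall n : nat, `|n%:R / t - z| < d -> `|g' z - g t n| < e / 2]).
      split => //=; near=> d1; apply/andP; split => //.
    by move=> [d1 t] /= [? ?].
  move=> [z' [d1 t]] /= [[g'zz' zz'] [/andP[d10 d1d] hq]] n nd.
  have nz : `|n%:R / t - z| < d.
    rewrite -(subrK z' (n%:R / t)) -addrA (le_lt_trans (ler_normD _ _))// [`|z' - z|]distrC; lra.
  have := hq n nz; move: g'zz'; rewrite !ler_norml !ltr_norml => /andP[? ?] /andP[? ?].
  by apply/andP; split; lra.
case: h => -[Q1 Q2] /= [hQ1 hQ2] hQ.
have [d [d0 Q1d]] : exists d : R, 0 < d /\ Q1 d.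
  near (0:R)^'+ => d; exists d; split => //; near: d; exact: hQ1.
exists d => //; apply: filterS hQ2 => t Q2t z n zab nd.
by apply: (hQ (d, t)) => //=; rewrite in_itv.
Unshelve. all: by end_near. Qed.

End limit.
End ratio_nbhs.

(** * Passage to a random sample size *)

Section random_index.
Context {R : realType} {d : measure_display} {T : measurableType d}.
Variables (P : probability T R) (N : R -> T -> nat) (Z : T -> R).
Hypotheses (mN : forall t, measurable_fun setT (N t)) (mZ : measurable_fun setT Z).
Hypothesis Z_gt0 : {ae P, forall w, 0 < Z w}.
Hypothesis NZ : cvg_in_probability (+oo : set_system R) P (fun t w => (N t w)%:R / t) Z.
Variables (g : R -> nat -> R) (g' : R -> R) (M : R).
Hypotheses (gM : forall t n, `|g t n| <= M) (g'M : forall z, `|g' z| <= M).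
Hypothesis mg' : measurable_fun setT g'.
Hypothesis g_cvg : forall z : R, 0 < z -> g p.1 p.2 @[p --> ratio_nbhs z] --> g' z.

(** Outside an event of small probability, [Z] lies in a compact interval of positive reals and
    [N t / t] is close to it, so the uniform limit applies; on that event boundedness suffices. *)
Lemma random_index_expectation_cvg :
  \int[P]_w g t (N t w) @[t --> +oo] --> \int[P]_w g' (Z w).
Proof.
apply/cvgrPdist_lt => e e0.
have M0 : 0 <= M := le_trans (normr_ge0 _) (g'M 0).
pose M1 := M + 1.
have M1_gt0 : 0 < M1 by rewrite ltr_wpDl.
(* The exceptional event will have probability below [2 * eta], contributing less than
   [4 * M1 * eta = e / 2]. *)
pose eta := e / (8 * M1).
have eta0 : 0 < eta by rewrite divr_gt0// mulr_gt0.
have Meta : M1 * eta = e / 8 by rewrite /eta; field; rewrite gt_eqF.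
(* Bounding the logarithm keeps a positive [Z w] away from 0 and from infinity alike. *)
have mlnZ : measurable_fun setT (fun w => `|ln (Z w)|).
  by apply: measurableT_comp => //; exact: measurableT_comp.
have [K K0 PK] := tail_lt P mlnZ eta0.
have e20 : 0 < e / 2 by rewrite divr_gt0.
have [del del0 unif] := ratio_limit_uniform g_cvg (expR K) (expR_gt0 (- K)) e20.
have del20 : 0 < del / 2 by rewrite divr_gt0.
(* Half of [del], since off [B1 t] only a weak inequality holds while [unif] wants a strict one. *)
pose B1 t := [set w | del / 2 < `|(N t w)%:R / t - Z w|].
pose B2 := [set w | K < `|ln (Z w)|].
(* Where [Z w] is not positive, a bound on [ln (Z w)] does not confine it; this event is null. *)
pose B3 := [set w | Z w <= 0].
have mgt (f : T -> R) c : measurable_fun setT f -> measurable [set w | c < f w].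
  move=> mf; rewrite (_ : mkset _ = setT `&` f @^-1` `]c, +oo[); first exact: mf.
  by rewrite setTI; apply/seteqP; split => w /=; rewrite in_itv /= andbT.
have mB1 t : measurable (B1 t).
  apply: mgt; apply: measurableT_comp => //; apply: measurable_funB => //.
  apply: measurable_funM => //.
  exact: (measurableT_comp (measurable_fun_nat (fun n : nat => n%:R : R)) (mN t)).
have mB2 : measurable B2 by exact: mgt.
have mB3 : measurable B3.
  rewrite (_ : B3 = setT `&` Z @^-1` `]-oo, 0]); first exact: mZ.
  by rewrite setTI; apply/seteqP; split => w /=; rewrite in_itv.
have PB3 : P B3 = 0%E.
  apply/negligibleP => //; apply: negligibleS Z_gt0 => w /= Zw /=.
  by apply/negP; rewrite -leNgt.
near=> t.
have PB1 : fine (P (B1 t)) < eta.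
  have : `|fine (P (B1 t))| < eta.
    by near: t; move/fine_cvgP : (NZ del20) => [_] /cvgr0Pnorm_lt /(_ _ eta0).
  exact/le_lt_trans/ler_norm.
pose B := B1 t `|` (B2 `|` B3).
have mB : measurable B by apply: measurableU => //; exact: measurableU.
have PB : fine (P B) < 2 * eta.
  apply: (@le_lt_trans _ _ (fine (P (B1 t)) + fine (P B2))); last first.
    by rewrite /B2 in PK *; lra.
  rewrite -fineD ?fin_num_measure//; apply: fine_le.
  - by rewrite fin_num_measure.
  - by rewrite fin_numD !fin_num_measure.
  - have le3 : (P B <= P (B1 t) + (P B2 + P B3))%E.
      apply: (@le_trans _ _ (P (B1 t) + P (B2 `|` B3))%E).
        by apply: measureU2 => //; exact: measurableU.
      by apply: leeD => //; exact: measureU2.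
    by rewrite PB3 adde0 in le3.
have bound w : `|g t (N t w) - g' (Z w)| <= e / 2 + 2 * M1 * \1_B w.
  rewrite indicE; have [wB|wB] := boolP (w \in B).
    rewrite mulr1; apply: le_trans (ler_normB _ _) _.
    by have := gM t (N t w); have := g'M (Z w); rewrite /M1; lra.
  rewrite mulr0 addr0; move: wB; rewrite notin_setE => wB.
  have Z0 : 0 < Z w by rewrite ltNge; apply/negP => h; apply: wB; right; right.
  have lnZ : `|ln (Z w)| <= K by rewrite leNgt; apply/negP => h; apply: wB; right; left.
  have NZw : `|(N t w)%:R / t - Z w| <= del / 2 by rewrite leNgt; apply/negP => h; apply: wB; left.
  have ZK : expR (- K) <= Z w <= expR K.
    by rewrite -[Z w]lnK ?posrE// !ler_expR -ler_norml.
  have NZw' : `|(N t w)%:R / t - Z w| < del by lra.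
  by move: (Z w) (N t w) ZK NZw'; near: t.
have mgN : measurable_fun setT (fun w => g t (N t w)).
  exact: (measurableT_comp (measurable_fun_nat (g t)) (mN t)).
have mg'Z : measurable_fun setT (fun w => g' (Z w)) by exact: measurableT_comp.
have mind : measurable_fun setT (fun w => \1_B w : R) by exact: measurable_indic.
have ind1 w : `|\1_B w : R| <= 1 by rewrite indicE normr_nat; case: (_ \in _).
have dist : `|\int[P]_w g t (N t w) - \int[P]_w g' (Z w)| <= e / 2 + 2 * M1 * fine (P B).
  rewrite -Rintegral_indicator// -(@Rintegral_affine _ _ _ P _ _ 1)//.
  apply: (@le_Rintegral_dist _ _ _ _ _ _ _ (e / 2 + 2 * M1)) => //.
  - by apply: measurable_funD => //; exact: measurable_funM.
  - by move=> w; have := gM t (N t w); rewrite /M1; lra.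
  - by move=> w; have := g'M (Z w); rewrite /M1; lra.
  - move=> w; rewrite indicE ger0_norm; first by case: (_ \in _); rewrite /= ?mulr1 ?mulr0; lra.
    by case: (_ \in _); rewrite /= ?mulr1 ?mulr0; lra.
rewrite distrC; apply: le_lt_trans dist _.
have : 2 * M1 * fine (P B) < 2 * M1 * (2 * eta) by rewrite ltr_pM2l// mulr_gt0.
lra.
Unshelve. all: by end_near. Qed.

End random_index.

(** * Generated sigma-algebras, upper sums and transfer between probability spaces *)

Section sigma_of_lemmas.
Context {d d' : measure_display}.
Context {T : measurableType d} {T' : measurableType d'} {I : Type}.
Variables (D : set I) (W : I -> T -> T').

Lemma sigma_of_preimage i B : D i -> measurable B -> sigma_of D W (W i @^-1` B).
Proof.
move=> Di mB; apply: sub_sigma_algebra; exists i => //; exists B => //.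
by rewrite setTI.
Qed.

Lemma sigma_of_measurable : (forall i, D i -> measurable_fun setT (W i)) ->
  sigma_of D W `<=` measurable.
Proof.
move=> mW; apply: smallest_sub; first exact: sigma_algebra_measurable.
by move=> _ [i Di [B mB <-]]; exact: mW.
Qed.

End sigma_of_lemmas.

Section upper_sum_lemmas.
Context {R : realType}.

Lemma measurable_upper_sum d (T : measurableType d) (p : nat) (k : 'I_p -> R)
    (X : nat -> T -> R) (n : nat) : (forall i, measurable_fun setT (X i)) ->
  measurable_fun setT (fun w => upper_sum k (X ^~ w) n).
Proof.
move=> mX; apply: measurable_sum => j; apply: measurable_funM => //.
exact: measurable_order_stat.
Qed.

(** Passes from the norming at the sample size, used in (iii), to the norming at [t]; the
    coefficients are those whose limits [norming_scale_shift_cvg] provides. *)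
Lemma upper_sum_renormalise (p : nat) (k : 'I_p -> R) (x : nat -> R) (n : nat)
    (at' bt an bn : R) : 0 < at' -> 0 < an ->
  (upper_sum k x n - bt * \sum_(j < p) k j) / at' =
  an / at' * (\sum_(j < p) k j * ((order_stat x (n - j) n - bn) / an)) +
  (\sum_(j < p) k j) * ((bn - bt) / at').
Proof.
move=> at0 an0.
have -> : \sum_(j < p) k j * ((order_stat x (n - j) n - bn) / an) =
    (upper_sum k x n - bn * \sum_(j < p) k j) / an.
  rewrite /upper_sum mulr_sumr -sumrB mulr_suml; apply: eq_bigr => j _.
  by ring.
by field; rewrite !gt_eqF.
Qed.

Lemma rV_coord_continuous {S : topologicalType} (m : nat) (j : 'I_m) :
  continuous (fun r : 'rV[S]_m => r 0 j).
Proof.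
move=> r B /= rB.
(* Neighbourhoods of a row vector are given entrywise; only column [j] is constrained. *)
exists (fun i' j' => [set x | j' = j -> B x]).
  move=> i' j'; have [->|jj] := pselect (j' = j).
    by rewrite ord1; apply: filterS rB => x Bx _.
  by apply: filterS filterT => x _ /jj.
by move=> s hs; exact: hs.
Qed.

Lemma weighted_sum_continuous {S : topologicalType} (m p : nat) (h : (p <= m)%N) (k : 'I_p -> R)
    (pr : S -> R) : continuous pr ->
  continuous (fun r : 'rV[S]_m => \sum_(j < p) k j * pr (r 0 (widen_ord h j))).
Proof.
move=> cpr; apply: (@continuous_big _ _ +%R 0 xpredT _ 'rV[S]_m _
  (fun j r => k j * pr (r 0 (widen_ord h j)))) => [|j _ r]; first exact: add_continuous.
have c : s 0 (widen_ord h j) @[s --> r] --> r 0 (widen_ord h j) by exact: rV_coord_continuous.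
have c' : pr (s 0 (widen_ord h j)) @[s --> r] --> pr (r 0 (widen_ord h j)).
  exact: (@cvg_comp _ _ _ (fun s : 'rV[S]_m => s 0 (widen_ord h j)) pr _ _ _ c (cpr _)).
exact: (@cvgMl_tmp _ _ (nbhs r) (nbhs_filter r) _ _ _ c').
Qed.

End upper_sum_lemmas.

Section distribution_transfer.
Context {R : realType}.

Lemma Rintegral_eq_distribution d (T : measurableType d) (P : probability T R)
    d' (T' : measurableType d') (P' : probability T' R)
    (Z : {RV P >-> R}) (Z' : {RV P' >-> R}) (g : R -> R) (M : R) :
  (forall A : set R, measurable A -> distribution P' Z' A = distribution P Z A) ->
  measurable_fun setT g -> (forall z, `|g z| <= M) ->
  \int[P]_w g (Z w) = \int[P']_w g (Z' w).
Proof.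
move=> ZZ' mg gM; rewrite /Rintegral; congr fine.
transitivity (\int[distribution P Z]_z (EFin \o g) z)%E.
  rewrite integral_distribution//; first exact/measurable_EFinP.
  apply: (@integrable_bounded _ _ _ P (g \o Z) M) => [|w]; last exact: gM.
  exact: measurableT_comp.
transitivity (\int[distribution P' Z']_z (EFin \o g) z)%E.
  by apply: eq_measure_integral => A mA _; exact/esym/ZZ'.
rewrite integral_distribution//; first exact/measurable_EFinP.
apply: (@integrable_bounded _ _ _ P' (g \o Z') M) => [|w]; last exact: gM.
exact: measurableT_comp.
Qed.

Lemma cvg_expectation_bounded {I : Type} (F : set_system I) {FF : Filter F}
    d (T : measurableType d) (P : probability T R) (f : I -> T -> R)
    d' (T' : measurableType d') (P' : probability T' R) (f' : T' -> R) (M : R) :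
  (forall i, measurable_fun setT (f i)) -> measurable_fun setT f' ->
  (forall i w, `|f i w| <= M) -> (forall w, `|f' w| <= M) ->
  ('E_P[f i] @[i --> F] --> 'E_P'[f'])%E <->
  \int[P]_w f i w @[i --> F] --> \int[P']_w f' w.
Proof.
move=> mf mf' fM f'M.
have -> : (fun i => 'E_P[f i]%E) = EFin \o (fun i => \int[P]_w f i w).
  by apply/funext => i; rewrite (expectation_bounded _ (mf i) (fM i)).
rewrite (expectation_bounded _ mf' f'M).
by split => [/fine_cvg//|h]; apply: cvg_EFin => //; exact: nearW.
Qed.

End distribution_transfer.

(** * Independence from a generated sigma-algebra *)

Section sub_sigma_algebra.
Context {R : realType} {d d1 d' : measure_display}.
Context {T : measurableType d} {T1 : measurableType d1} {T' : measurableType d'}.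
Variables (P : probability T R) (I : Type) (D : set I) (W : I -> T -> T').
Hypothesis mW : forall i, D i -> measurable_fun setT (W i).

Let G : set (set T) := \bigcup_(i in D) preimage_set_system setT (W i) measurable.

Lemma measurable_sigma_of i : D i ->
  measurable_fun setT (W i : g_sigma_algebraType G -> T').
Proof.
by move=> Di _ B mB; rewrite setTI; exact: sigma_of_preimage.
Qed.

Lemma measurable_id_sigma_of : measurable_fun setT (id : T -> g_sigma_algebraType G).
Proof. by move=> _ B mB; rewrite setTI; exact: (sigma_of_measurable mW). Qed.

Variables (U : {RV P >-> T1}) (A : set (set T)).
Hypothesis UA : forall B, measurable B -> A (U @^-1` B).
Hypothesis indep : independent P A (sigma_of D W).
Variables (h : T1 * T -> R) (M : R).
Hypothesis mh : measurable_fun setT (h : T1 * g_sigma_algebraType G -> R).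
Hypothesis hM : forall z, `|h z| <= M.

(** The identity into [T] with the generated sigma-algebra is a single random element carrying the
    whole family [W], so independence of sigma-algebras becomes independence of two random
    elements. *)
Let idG : {RV P >-> g_sigma_algebraType G} :=
  HB.pack (id : T -> g_sigma_algebraType G)
    (isMeasurableFun.Build _ _ _ _ _ measurable_id_sigma_of).

Lemma measurable_sub_expectation : measurable_fun setT (fun x => \int[P]_w h (x, w)).
Proof. exact: (measurable_partial_expectation U idG mh hM). Qed.

Lemma expectation_sub_independent :
  \int[P]_w h (U w, w) = \int[P]_w \int[P]_w' h (U w, w').
Proof.
apply: (@expectation_independent _ _ _ P _ _ _ _ U idG _ h M) => // B C mB mC.
by apply: indep; [exact: UA|exact: mC].
Qed.

End sub_sigma_algebra.

(** * Convergence of the randomly indexed sums *)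

Lemma measurable_ev_shift {R : realType} (L : ev_law R) : measurable_fun setT (ev_shift L).
Proof.
case: L => [a|a|]; [exact: measurable_cst|exact: measurable_cst|].
exact: (@measurable_ln R).
Qed.

Theorem proposition3p1 (R : realType)
  (d : measure_display) (T : measurableType d) (P : probability T R)
  (* X n, Y n, n >= 0, are the X_{n+1}, Y_{n+1} of the usual numbering *)
  (X Y : nat -> {RV P >-> R}) (F : R -> R -> R)
  (hF : forall n, joint_df P (X n) (Y n) = F)
  (N : R -> {RV P >-> nat})
  (hN : independent P
          (sigma_of [set t : R | 0 <= t] (fun t => N t : T -> nat))
          (sigma_of [set: nat] (fun n w => (X n w, Y n w))))
  (p q : nat) (k1 : 'I_p -> R) (k2 : 'I_q -> R)
  (* (i) *)
  (Z : {RV P >-> R})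
  (hZpos : {ae P, forall w, 0 < Z w})
  (hZ : cvg_in_probability (+oo : set_system R) P
          (fun t w => (N t w)%:R / t) Z)
  (* (ii) *)
  (a1 b1 a2 b2 : R -> R)
  (ha1 : forall t, 0 < t -> 0 < a1 t) (ha2 : forall t, 0 < t -> 0 < a2 t)
  (H : R -> R -> R)
  (hHdf : bivariate_df H) (hHms : max_stable H)
  (hH1 : exists L : ev_law R, marginal1 H = ev_df L)
  (hH2 : exists L : ev_law R, marginal2 H = ev_df L)
  (hFH : sup [set `| F (a1 t * z.1 + b1 t) (a2 t * z.2 + b2 t) `^ t
                     - H z.1 z.2 | | z in [set: R * R]]
           @[t --> +oo] --> 0)
  (* (iii); the limit vectors live on a probability space of their own, which
     also carries a copy of Z independent of them *)
  (m : nat) (hp : (p <= m)%N) (hq : (q <= m)%N)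
  (d' : measure_display) (T' : measurableType d') (P' : probability T' R)
  (XX YY : 'I_m -> {RV P' >-> R})
  (hXY : cvg_in_distribution \oo P
           (fun (n : nat) w => \row_(j < m)
              ((order_stat (X ^~ w) (n - j) n - b1 n%:R) / a1 n%:R,
               (order_stat (Y ^~ w) (n - j) n - b2 n%:R) / a2 n%:R))
           P'
           (fun w => \row_(j < m) (XX j w, YY j w)))
  (ZZ : {RV P' >-> R})
  (hZZ : forall A : set R, measurable A ->
           distribution P' ZZ A = distribution P Z A)
  (hZZind : independent P'
              (sigma_of [set: unit] (fun=> ZZ : T' -> R))
              (sigma_of [set: 'I_m] (fun j w => (XX j w, YY j w)))) :
  let S1 t w := upper_sum k1 (X ^~ w) (N t w) in
  let S2 t w := upper_sum k2 (Y ^~ w) (N t w) in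
  let c1 := \sum_(j < p) k1 j in
  let c2 := \sum_(j < q) k2 j in
  let gamma1 := mda_gamma (marginal1 F) in
  let gamma2 := mda_gamma (marginal2 F) in
  let delta1 := mda_delta (marginal1 F) in
  let delta2 := mda_delta (marginal2 F) in
  cvg_in_distribution (+oo : set_system R) P
    (fun t w => ((S1 t w - b1 t * c1) / a1 t, (S2 t w - b2 t * c2) / a2 t))
    P'
    (fun w =>
      (ZZ w `^ gamma1 * (\sum_(j < p) k1 j * XX (widen_ord hp j) w)
         + c1 * delta1 (ZZ w),
       ZZ w `^ gamma2 * (\sum_(j < q) k2 j * YY (widen_ord hq j) w)
         + c2 * delta2 (ZZ w))).
Proof.
move=> S1 S2 c1 c2 gamma1 gamma2 delta1 delta2.
have [L1 HL1] := hH1; have [L2 HL2] := hH2.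
have hF2 : monotone_df2 F by rewrite -(hF 0); apply: monotone_df2_joint_df.
have hH2' : monotone_df2 H.
  by have [mu ->] := hHdf; apply: monotone_df2_joint_df;
    [exact: measurable_fst|exact: measurable_snd].
have F1_cvg x : marginal1 F (a1 t * x + b1 t) `^ t @[t --> +oo] --> ev_df L1 x.
  by rewrite -HL1; exact: (marginal1_power_cvg hF2 hH2' ha2 hFH).
have F2_cvg x : marginal2 F (a2 t * x + b2 t) `^ t @[t --> +oo] --> ev_df L2 x.
  by rewrite -HL2; exact: (marginal2_power_cvg hF2 hH2' ha1 hFH).
have F1_nd : {homo marginal1 F : x y / x <= y} by exact: marginal1_homo.
have F1_ge0 x : 0 <= marginal1 F x by exact: marginal1_ge0.
have hF2s := monotone_df2_swap hF2.
have F2_nd : {homo marginal2 F : x y / x <= y} by exact: (marginal1_homo hF2s).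
have F2_ge0 x : 0 <= marginal2 F x by exact: (marginal1_ge0 hF2s).
(* [gamma] and [delta] are defined from the marginals of [F]; uniqueness expresses them by the laws
   of the marginals of [H]. *)
have g1E : gamma1 = ev_exponent L1 by exact: (mda_gammaE F1_nd F1_ge0 ha1 F1_cvg).
have g2E : gamma2 = ev_exponent L2 by exact: (mda_gammaE F2_nd F2_ge0 ha2 F2_cvg).
have d1E : delta1 = ev_shift L1 by exact: (mda_deltaE F1_nd F1_ge0 ha1 F1_cvg).
have d2E : delta2 = ev_shift L2 by exact: (mda_deltaE F2_nd F2_ge0 ha2 F2_cvg).
rewrite {}g1E {}g2E {}d1E {}d2E => f cf [M fM].
(* The sums under the norming of (iii), taken at the sample size itself. *)
pose U n w := \sum_(j < p) k1 j * ((order_stat (X ^~ w) (n - j) n - b1 n%:R) / a1 n%:R).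
pose V n w := \sum_(j < q) k2 j * ((order_stat (Y ^~ w) (n - j) n - b2 n%:R) / a2 n%:R).
pose U' w := \sum_(j < p) k1 j * XX (widen_ord hp j) w.
pose V' w := \sum_(j < q) k2 j * YY (widen_ord hq j) w.
have mU n : measurable_fun setT (U n).
  apply: measurable_sum => j; apply: measurable_funM => //; apply: measurable_funM => //.
  by apply: measurable_funB => //; exact: measurable_order_stat.
have mV n : measurable_fun setT (V n).
  apply: measurable_sum => j; apply: measurable_funM => //; apply: measurable_funM => //.
  by apply: measurable_funB => //; exact: measurable_order_stat.
have mU' : measurable_fun setT U' by apply: measurable_sum => j; exact: measurable_funM.
have mV' : measurable_fun setT V' by apply: measurable_sum => j; exact: measurable_funM.
(* Continuous mapping: both sums are a continuous function [Phi] of the row vector in (iii). *)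
have UV_cvg (f0 : R * R -> R) : continuous f0 -> (exists M, forall z, `|f0 z| <= M) ->
    \int[P]_w f0 (U n w, V n w) @[n --> \oo] --> \int[P']_w f0 (U' w, V' w).
  move=> cf0 [M0 f0M].
  pose Phi (r : 'rV[R * R]_m) := (\sum_(j < p) k1 j * (r 0 (widen_ord hp j)).1,
                                 \sum_(j < q) k2 j * (r 0 (widen_ord hq j)).2).
  have cPhi : continuous Phi.
    move=> r.
    have e1 := @weighted_sum_continuous R _ m p hp k1 (fun z : R * R => z.1) (fun z => cvg_fst) r.
    have e2 := @weighted_sum_continuous R _ m q hq k2 (fun z : R * R => z.2) (fun z => cvg_snd) r.
    have FFr : Filter (nbhs r) := nbhs_filter r.
    by apply: (@cvg_pair _ _ _ (nbhs r) (nbhs (Phi r).1) (nbhs (Phi r).2));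
      [exact: e1|exact: e2].
  have cf0Phi : continuous (f0 \o Phi).
    by move=> r; apply: continuous_comp; [exact: cPhi|exact: cf0].
  have := hXY _ cf0Phi (ex_intro _ M0 (fun r => f0M (Phi r))).
  pose row_stat n w : 'rV[R * R]_m := \row_(j < m)
      ((order_stat (X ^~ w) (n - j) n - b1 n%:R) / a1 n%:R,
       (order_stat (Y ^~ w) (n - j) n - b2 n%:R) / a2 n%:R).
  have -> : (fun n => 'E_P[f0 \o Phi \o row_stat n]%E) =
      (fun n => 'E_P[fun w => f0 (U n w, V n w)]%E).
    apply/funext => n; congr expectation; apply/funext => w /=; rewrite /Phi /U /V.
    by congr (f0 (_, _)); apply: eq_bigr => j _; rewrite mxE.
  have -> : f0 \o Phi \o (fun w => \row_(j < m) (XX j w, YY j w)) = (fun w => f0 (U' w, V' w)).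
    apply/funext => w /=; rewrite /Phi /U' /V'.
    by congr (f0 (_, _)); apply: eq_bigr => j _; rewrite mxE.
  have mf0 := continuous_measurable_fun2 cf0.
  have mf0UV n : measurable_fun setT (fun w => f0 (U n w, V n w)).
    by apply: measurableT_comp => //; exact: measurable_fun_pair.
  have mf0UV' : measurable_fun setT (fun w => f0 (U' w, V' w)).
    by apply: measurableT_comp => //; exact: measurable_fun_pair.
  by move/(cvg_expectation_bounded P P' mf0UV mf0UV' (fun n w => f0M _) (fun w => f0M _)).
(* The sample size is kept apart from the sample point, so that the sample can be integrated out
   first. *)
pose h t (z : nat * T) := f ((upper_sum k1 (X ^~ z.2) z.1 - b1 t * c1) / a1 t,
                             (upper_sum k2 (Y ^~ z.2) z.1 - b2 t * c2) / a2 t).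
pose h' (z : R * T') := f (affine2 (z.1 `^ ev_exponent L1) (c1 * ev_shift L1 z.1)
   (z.1 `^ ev_exponent L2) (c2 * ev_shift L2 z.1) (U' z.2, V' z.2)).
pose g t n := \int[P]_w h t (n, w).
pose g' z := \int[P']_w h' (z, w).
have mXXYY i : [set: 'I_m] i -> measurable_fun setT (fun w => (XX i w, YY i w)).
  by move=> _; exact: measurable_fun_pair.
have mXYn i : [set: nat] i -> measurable_fun setT (fun w => (X i w, Y i w)).
  by move=> _; exact: measurable_fun_pair.
have cfm := continuous_measurable_fun2 cf.
(* Independence concerns the sigma-algebras generated by the sample and by the limit vectors, so [h]
   and [h'] are shown measurable with respect to these. *)
pose GT := \bigcup_(i in [set: nat]) preimage_set_system setT (fun w => (X i w, Y i w)) measurable.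
pose GT' := \bigcup_(i in [set: 'I_m])
  preimage_set_system setT (fun w => (XX i w, YY i w)) measurable.
have mXY n : measurable_fun setT ((fun w => (X n w, Y n w)) : g_sigma_algebraType GT -> _).
  exact: measurable_sigma_of.
have mXX j : measurable_fun setT ((fun w => (XX j w, YY j w)) : g_sigma_algebraType GT' -> _).
  exact: measurable_sigma_of.
have mX n : measurable_fun setT (X n : g_sigma_algebraType GT -> R) :=
  measurableT_comp measurable_fst (mXY n).
have mY n : measurable_fun setT (Y n : g_sigma_algebraType GT -> R) :=
  measurableT_comp measurable_snd (mXY n).
have mXX1 n : measurable_fun setT (XX n : g_sigma_algebraType GT' -> R) :=
  measurableT_comp measurable_fst (mXX n).
have mYY n : measurable_fun setT (YY n : g_sigma_algebraType GT' -> R) :=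
  measurableT_comp measurable_snd (mXX n).
have mh t : measurable_fun setT (h t : nat * g_sigma_algebraType GT -> R).
  apply: measurable_fun_nat_prod => n; rewrite /h /=; apply: (measurableT_comp cfm).
  by apply: measurable_fun_pair; apply: measurable_funM => //; apply: measurable_funB => //;
    exact: measurable_upper_sum.
have m1 : measurable_fun setT (fst : R * g_sigma_algebraType GT' -> R) by exact: measurable_fst.
have m2 : measurable_fun setT (snd : R * g_sigma_algebraType GT' -> g_sigma_algebraType GT')
  by exact: measurable_snd.
have mh' : measurable_fun setT (h' : R * g_sigma_algebraType GT' -> R).
  have mpow (L : ev_law R) : measurable_fun setT
      (fun z : R * g_sigma_algebraType GT' => z.1 `^ ev_exponent L).
    exact: (measurableT_comp (measurable_powR (ev_exponent L)) m1).
  have mshift (L : ev_law R) : measurable_fun setT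
      (fun z : R * g_sigma_algebraType GT' => ev_shift L z.1).
    exact: (measurableT_comp (measurable_ev_shift L) m1).
  have mU2 : measurable_fun setT (fun z : R * g_sigma_algebraType GT' => U' z.2).
    apply: (measurableT_comp (f := (U' : g_sigma_algebraType GT' -> R)) _ m2).
    by apply: measurable_sum => j; exact: measurable_funM.
  have mV2 : measurable_fun setT (fun z : R * g_sigma_algebraType GT' => V' z.2).
    apply: (measurableT_comp (f := (V' : g_sigma_algebraType GT' -> R)) _ m2).
    by apply: measurable_sum => j; exact: measurable_funM.
  rewrite /h' /affine2 /=; apply: (measurableT_comp cfm).
  apply: measurable_fun_pair; apply: measurable_funD;
    by apply: measurable_funM.
have hM t z : `|h t z| <= M by exact: fM.
have h'M z : `|h' z| <= M by exact: fM.
have mg' : measurable_fun setT g' by exact: (measurable_sub_expectation mXXYY ZZ mh' h'M).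
have mid := measurable_id_sigma_of mXYn.
have mid' := measurable_id_sigma_of mXXYY.
have mhT t n : measurable_fun setT (fun w => h t (n, w)).
  exact: (measurableT_comp (mh t) (measurable_fun_pair (measurable_cst n) mid)).
have gM t n : `|g t n| <= M by apply: Rintegral_bounded.
have mh'T z : measurable_fun setT (fun w => h' (z, w)).
  by rewrite /h' /=; apply: measurable_affine2.
have g'M z : `|g' z| <= M by apply: Rintegral_bounded.
(* Deterministic sample size: Slutsky's theorem along [ratio_nbhs z], with the limits of the norming
   ratios as coefficients. *)
have g_cvg z : 0 < z -> g r.1 r.2 @[r --> ratio_nbhs z] --> g' z.
  move=> z0.
  have r1 := @ratio_nbhs_fst R z; have r2 := @ratio_nbhs_ratio R z.
  have r3 := ratio_nbhs_snd z0.
  have [A1_cvg B1_cvg] := norming_scale_shift_cvg F1_nd F1_ge0 ha1 F1_cvg z0 r1 r2.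
  have [A2_cvg B2_cvg] := norming_scale_shift_cvg F2_nd F2_ge0 ha2 F2_cvg z0 r1 r2.
  have UVr (f0 : R * R -> R) : continuous f0 -> (exists M, forall z, `|f0 z| <= M) ->
      \int[P]_w f0 (U r.2 w, V r.2 w) @[r --> ratio_nbhs z] --> \int[P']_w f0 (U' w, V' w).
    by move=> cf0 f0M; exact: (cvg_comp _ _ r3 (UV_cvg f0 cf0 f0M)).
  have lim : \int[P]_w f (affine2 (a1 r.2%:R / a1 r.1) (c1 * ((b1 r.2%:R - b1 r.1) / a1 r.1))
      (a2 r.2%:R / a2 r.1) (c2 * ((b2 r.2%:R - b2 r.1) / a2 r.1)) (U r.2 w, V r.2 w))
      @[r --> ratio_nbhs z] --> g' z.
    exact: (@cvg_affine2_distribution _ _ _ P _ _ P' _ (ratio_nbhs z) _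
      (fun r => U r.2) (fun r => V r.2) U' V' (fun r => mU r.2) (fun r => mV r.2) mU' mV' UVr
      _ _ _ _ _ _ _ _ A1_cvg (cvgMl_tmp (a := c1) B1_cvg) A2_cvg (cvgMl_tmp (a := c2) B2_cvg)
      f cf (ex_intro _ M fM)).
  apply: cvg_trans lim; apply: near_eq_cvg; near=> r.
  (* The scale functions are positive at positive arguments, so the renormalisation is valid
     eventually. *)
  have r20 : 0 < (r.2%:R : R).
    by rewrite ltr0n; near: r; exact: (r3 _ (nbhs_infty_gt 0)).
  have r10 : 0 < r.1 by near: r; move/cvgryPgt : r1; exact.
  rewrite /g /h /=; apply: eq_Rintegral => w _; congr f.
  by rewrite /affine2 /=; congr (_, _);
    [apply/esym/(upper_sum_renormalise _ _ _ (b1 _))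
      |apply/esym/(upper_sum_renormalise _ _ _ (b2 _))];
    by [exact: ha1|exact: ha2].
have mS t : measurable_fun setT (fun w => h t (N t w, w)).
  exact: (measurableT_comp (mh t) (measurable_fun_pair (measurable_funPT (N t)) mid)).
have mS' : measurable_fun setT (fun w => h' (ZZ w, w)).
  exact: (measurableT_comp mh' (measurable_fun_pair (measurable_funPT ZZ) mid')).
apply/(cvg_expectation_bounded P P' mS mS' (fun t w => fM _) (fun w => fM _)).
(* On the limit side the vectors are integrated out by independence; then [ZZ] is replaced by [Z],
   which has the same law. *)
have -> : \int[P']_w h' (ZZ w, w) = \int[P]_w g' (Z w).
  rewrite (@expectation_sub_independent _ _ _ _ _ _ _ P' _ setT (fun j w => (XX j w, YY j w)) mXXYY
    ZZ _ _ hZZind h' M mh' h'M).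
    by rewrite (Rintegral_eq_distribution hZZ mg' g'M).
  by move=> B mB; exact: sigma_of_preimage.
have lim := random_index_expectation_cvg (fun t => measurable_funPT (N t)) (measurable_funPT Z)
  hZpos hZ gM g'M mg' g_cvg.
(* Independence covers [N t] for [0 <= t], which holds for large [t]. *)
apply: cvg_trans lim; apply: near_eq_cvg; near=> t.
rewrite (@expectation_sub_independent _ _ _ _ _ _ _ P _ setT (fun n w => (X n w, Y n w)) mXYn
    (N t) _ _ hN (h t) M (mh t) (hM t)) //.
move=> B mB; apply: sigma_of_preimage => //=.
Unshelve. all: by end_near. Qed.
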